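(* Let $\mathbb{F}$ be a field of odd characteristic $p$, let $\mathbf{n}=(n_1,n_2)$ be a pair of positive integers, and let $L=H(2:\mathbf{n};\omega_2)$ be the Hamiltonian Lie algebra over $\mathbb{F}$. A basis for the second cohomology group $H^2(L,\mathbb{F})$ (with values in the trivial module $\mathbb{F}$) is given by the classes of the cocycles $\varphi_r$, for $0<r\le n_2$, and $\psi_s$, for $0<s\le n_1$, which are the bilinear maps $L\times L\to\mathbb{F}$ defined on the monomial basis of $L$ by $$\varphi_r(x^{(i)}y^{(j)},x^{(k)}y^{(l)})=\begin{cases}(-1)^{i+j}&\text{if }(i+k,j+l)\equiv(0,p^r)\pmod{(p^{n_1}-1,p^{n_2}-1)},\\0&\text{otherwise;}\end{cases}$$ $$\psi_s(x^{(i)}y^{(j)},x^{(k)}y^{(l)})=\begin{cases}(-1)^{i+j+1}&\text{if }(i+k,j+l)\equiv(p^s,0)\pmod{(p^{n_1}-1,p^{n_2}-1)},\\0&\text{otherwise.}\end{cases}$$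
   Context: Divided powers: $\mathbb{F}[2:\mathbf{n}]=\mathbb{F}[x,y;n_1,n_2]$ is the commutative associative $\mathbb{F}$-algebra with basis the monomials $x^{(i)}y^{(j)}$, $0\le i<p^{n_1}$, $0\le j<p^{n_2}$, and multiplication $x^{(i)}y^{(j)}\cdot x^{(k)}y^{(l)}=\binom{i+k}{i}\binom{j+l}{j}x^{(i+k)}y^{(j+l)}$ (monomials with an exponent outside the allowed range are zero); $x^{(0)}y^{(0)}=1$. The derivations $\partial/\partial x$, $\partial/\partial y$ send $x^{(i)}y^{(j)}$ to $x^{(i-1)}y^{(j)}$ and $x^{(i)}y^{(j-1)}$ respectively (zero if an exponent becomes negative); write $f_x,f_y$ for the partial derivatives of $f$. Put $\bar x=x^{(p^{n_1}-1)}$, $\bar y=y^{(p^{n_2}-1)}$, $e=\bar x\bar y$. The Hamiltonian algebra $H(2:\mathbf{n};\omega_2)$ is the second derived algebra of the Lie algebra of those derivations $D=f\,\partial/\partial x+g\,\partial/\partial y$ ($f,g\in\mathbb{F}[2:\mathbf{n}]$) which annihilate the differential form $\omega_2=(1-e)\,dx\wedge dy$. It is identified with the quotient space $\mathbb{F}[2:\mathbf{n}]/\langle 1\rangle$, of dimension $p^{n_1+n_2}-1$, with Lie bracket induced by the Poisson bracket $\{f,g\}=(1+e)(f_yg_x-f_xg_y)$; the class of $x^{(i)}y^{(j)}$ modulo $\langle 1\rangle$ is still denoted $x^{(i)}y^{(j)}$, so the monomials with $(i,j)\ne(0,0)$ form a basis of $L$. A congruence of pairs modulo $(p^{n_1}-1,p^{n_2}-1)$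 means that the difference of the two pairs lies in the subgroup of $\mathbb{Z}^2$ generated by the single vector $(p^{n_1}-1,p^{n_2}-1)$. *)

(* Defs.v *)
From HB Require Import structures.
From mathcomp Require Import all_boot all_order all_algebra ring.
From mathcomp Require Import boolp.

Set Implicit Arguments.
Unset Strict Implicit.
Unset Printing Implicit Defensive.

Import GRing.Theory.
Local Open Scope ring_scope.

Section Comprehension.
Variables (K : fieldType) (V : vectType K).

Definition vspace_of (P : V -> Prop) : {vspace V} :=
  if pselect (exists U : {vspace V}, forall v, v \in U <-> P v) is left exU
  then projT1 (cid exU) else 0%VS.

Lemma mem_vspace_of (P : V -> Prop) :
  P 0 -> (forall a u v, P u -> P v -> P (a *: u + v)) ->
  forall v, v \in vspace_of P <-> P v.
Proof.
move=> P0 PD; rewrite /vspace_of; case: pselect => [exU|[]]; first by case: cid.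
pose Q := [pred n | `[< exists2 U : {vspace V}, \dim U = n
                        & forall v, v \in U -> P v >]].
have exQ : exists n, Q n.
  exists 0%N; apply/asboolP; exists 0%VS; first exact: dimv0.
  by move=> v; rewrite memv0 => /eqP->.
have ubQ n : Q n -> (n <= \dim {:V})%N.
  by case/asboolP => U <- _; apply/dimvS/subvf.
case: (ex_maxnP exQ ubQ) => n /asboolP[U dimU UP] maxU.
exists U => v; split=> [/UP//|Pv].
have : Q (\dim (U + <[v]>)).
  apply/asboolP; exists (U + <[v]>)%VS => // _ /memv_addP[u uU [_ /vlineP[a ->] ->]].
  by rewrite addrC; apply: PD => //; apply: UP.
move/maxU; rewrite -dimU => le_dim.
have /eqP -> : U == (U + <[v]>)%VS by rewrite eqEdim addvSl.
by rewrite (subvP (addvSr _ _)) ?memv_line.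
Qed.

End Comprehension.

Section Quotient.
Variables (K : fieldType) (V : vectType K) (U : {vspace V}).

(* V / U, realised on the complement U^C; [quot_pi] is the canonical
   surjection (its kernel is U) and [quot_repr] picks a representative. *)
Definition quotv : vectType K := subvs_of (U^C)%VS.

Definition quot_repr (a : quotv) : V := vsval a.

Definition quot_pi : 'Hom(V, quotv) :=
  linfun (vsproj (U^C)%VS \o daddv_pi (U^C)%VS U).

Lemma quot_reprP a b v : quot_repr (a *: b + v) = a *: quot_repr b + quot_repr v.
Proof. by rewrite /quot_repr linearP. Qed.

Lemma quot_repr0 : quot_repr 0 = 0.
Proof. exact: (linear0 (@vsval _ _ (U^C)%VS)). Qed.

Let capCU : (U^C :&: U)%VS = 0%VS. Proof. by rewrite capvC capv_compl. Qed.

Let quot_piE v : vsval (quot_pi v) = daddv_pi (U^C)%VS U v.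
Proof. by rewrite lfunE /= vsprojK //; apply: memv_pi. Qed.

Lemma quot_reprK : cancel quot_repr quot_pi.
Proof.
move=> a; apply: val_inj; rewrite /= quot_piE daddv_pi_id //; exact: subvsP.
Qed.

Lemma quot_pi_repr v : v - quot_repr (quot_pi v) \in U.
Proof.
rewrite /quot_repr quot_piE.
have vT : v \in (U^C + U)%VS by rewrite addvC addv_complf memvf.
by rewrite -{1}(daddv_pi_add capCU vT) [X in X - _]addrC addrK; apply: memv_pi.
Qed.

Lemma lker_quot_pi : lker quot_pi = U.
Proof.
apply/vspaceP => v; rewrite memv_ker; apply/eqP/idP => [v0|vU].
  by have := quot_pi_repr v; rewrite v0 quot_repr0 subr0.
apply: val_inj; rewrite /= quot_piE; apply: etrans (esym quot_repr0).
have vT : v \in (U^C + U)%VS by rewrite addvC addv_complf memvf.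
have := daddv_pi_add capCU vT.
by rewrite (daddv_pi_id (capv_compl U) vU) => /(canRL (addrK _)) ->; rewrite subrr.
Qed.

Lemma quot_piP u v : quot_pi u = quot_pi v <-> u - v \in U.
Proof.
have -> : (u - v \in U) = (u - v \in lker quot_pi) by rewrite lker_quot_pi.
rewrite memv_ker linearB subr_eq0.
by split=> [e|/eqP//]; apply/eqP.
Qed.

End Quotient.

Arguments quot_repr {K V U} a : simpl never.
Arguments quot_pi {K V} U : simpl never.

Section Cohomology.
Variables (K : fieldType) (L : vectType K) (br : L -> L -> L).

Definition lie_bracket : Prop :=
  [/\ forall a x y z, br (a *: x + y) z = a *: br x z + br y z,
      forall a x y z, br z (a *: x + y) = a *: br z x + br z y,
      forall x, br x x = 0
    & forall x y z, br (br x y) z + br (br y z) x + br (br z x) y = 0].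

Definition form1 : vectType K := 'Hom(L, K^o).
Definition form2 : vectType K := 'Hom(L, form1).

Implicit Type theta : form2.

Definition is_cocycle2 theta : Prop :=
  (forall x, theta x x = 0) /\
  (forall x y z, theta (br x y) z + theta (br y z) x + theta (br z x) y = 0).

Definition is_coboundary2 theta : Prop :=
  exists f : form1, forall x y, theta x y = f (br x y).

Definition Z2 : {vspace form2} := vspace_of is_cocycle2.
Definition B2 : {vspace form2} := vspace_of is_coboundary2.

(* H^2 = Z^2 / B^2, as a subspace of form2 / B^2 *)
Definition cohom_class (theta : form2) : quotv B2 := quot_pi B2 theta.
Definition H2 : {vspace quotv B2} := (quot_pi B2 @: Z2)%VS.

Let lfE := (zero_lfunE, add_lfunE, scale_lfunE).

Lemma form2P a (u v : form2) x y : (a *: u + v) x y = a * u x y + v x y.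
Proof. by rewrite !lfE. Qed.

Lemma mem_Z2 theta : theta \in Z2 <-> is_cocycle2 theta.
Proof.
apply: mem_vspace_of => [|a u v [u0 uJ] [v0 vJ]].
  by split=> *; rewrite !lfE ?addr0.
split=> [x|x y z]; rewrite !form2P ?u0 ?v0 ?mulr0 ?addr0 //.
have := uJ x y z; have := vJ x y z.
set b := u _ _; set c := u _ _; set d := u _ _.
set b' := v _ _; set c' := v _ _; set d' := v _ _ => e e'.
by transitivity (a * (b + c + d) + (b' + c' + d'));
  [ring | rewrite e e' mulr0 addr0].
Qed.

Lemma mem_B2 theta : theta \in B2 <-> is_coboundary2 theta.
Proof.
apply: mem_vspace_of => [|a u v [f uf] [g vg]].
  by exists 0 => x y; rewrite !lfE.
by exists (a *: f + g) => x y; rewrite !lfE uf vg.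
Qed.

Lemma B2_sub_Z2 : lie_bracket -> (B2 <= Z2)%VS.
Proof.
case=> _ _ brxx jac; apply/subvP => theta /mem_B2[f ef]; apply/mem_Z2.
split=> [x|x y z]; first by rewrite ef brxx linear0.
by rewrite !ef -!linearD /= jac linear0.
Qed.

End Cohomology.

Section DividedPowers.
Variables (F : fieldType) (p n1 n2 : nat).

(* f a b is the coefficient of x^(a) y^(b) *)
Definition dpa := 'M[F]_(p ^ n1, p ^ n2).
HB.instance Definition _ := Vector.on dpa.

(* x^(i) y^(j), which is 0 if an exponent is out of range *)
Definition dpmon (i j : nat) : dpa :=
  \matrix_(a, b) ((a == i :> nat) && (b == j :> nat))%:R.

Definition dpmul (f g : dpa) : dpa :=
  \sum_(a < p ^ n1) \sum_(b < p ^ n2) \sum_(c < p ^ n1) \sum_(d < p ^ n2)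
    (f a b * g c d * ('C(a + c, a) * 'C(b + d, b))%:R) *: dpmon (a + c) (b + d).

Definition dpdx (f : dpa) : dpa :=
  \sum_(a < p ^ n1) \sum_(b < p ^ n2)
    f a b *: (if a == 0%N :> nat then 0 else dpmon a.-1 b).
Definition dpdy (f : dpa) : dpa :=
  \sum_(a < p ^ n1) \sum_(b < p ^ n2)
    f a b *: (if b == 0%N :> nat then 0 else dpmon a b.-1).

Lemma dpmonE (f : dpa) :
  f = \sum_(a < p ^ n1) \sum_(b < p ^ n2) f a b *: dpmon a b.
Proof.
rewrite {1}[f]matrix_sum_delta.
apply: eq_bigr => a _; apply: eq_bigr => b _; congr (_ *: _).
by apply/matrixP => c d; rewrite !mxE.
Qed.

Lemma dpmon_out i j : (p ^ n1 <= i)%N || (p ^ n2 <= j)%N -> dpmon i j = 0.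
Proof.
move=> out; apply/matrixP => a b; rewrite !mxE.
case: eqP => // ai; case: eqP => // bj; move: out.
by rewrite -ai -bj leqNgt ltn_ord leqNgt ltn_ord.
Qed.

Lemma dpa_ind (P : dpa -> Prop) :
  P 0 -> (forall c f g, P f -> P g -> P (c *: f + g)) ->
  (forall i j, (i < p ^ n1)%N -> (j < p ^ n2)%N -> P (dpmon i j)) ->
  forall f, P f.
Proof.
move=> P0 PD Pm f; rewrite [f]dpmonE.
have PA g h : P g -> P h -> P (g + h) by move=> Pg Ph; rewrite -[g]scale1r; apply: PD.
apply: (big_ind P) => // a _; apply: (big_ind P) => // b _.
by rewrite -[_ *: _]addr0; apply: PD => //; apply: Pm.
Qed.

Lemma dpmulDl c f g h : dpmul (c *: f + g) h = c *: dpmul f h + dpmul g h.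
Proof.
rewrite /dpmul scaler_sumr -big_split; apply: eq_bigr => a _ /=.
rewrite scaler_sumr -big_split; apply: eq_bigr => b _ /=.
rewrite scaler_sumr -big_split; apply: eq_bigr => a' _ /=.
rewrite scaler_sumr -big_split; apply: eq_bigr => b' _ /=.
by rewrite scalerA -scalerDl !mxE !mulrA !mulrDl.
Qed.

Lemma dpmulDr c f g h : dpmul h (c *: f + g) = c *: dpmul h f + dpmul h g.
Proof.
rewrite /dpmul scaler_sumr -big_split; apply: eq_bigr => a _ /=.
rewrite scaler_sumr -big_split; apply: eq_bigr => b _ /=.
rewrite scaler_sumr -big_split; apply: eq_bigr => a' _ /=.
rewrite scaler_sumr -big_split; apply: eq_bigr => b' _ /=.
rewrite scalerA -scalerDl !mxE; congr (_ *: _); ring.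
Qed.

Lemma sum_dpmon (V : lmodType F) (G : nat -> nat -> V) i j :
  (i < p ^ n1)%N -> (j < p ^ n2)%N ->
  \sum_(a < p ^ n1) \sum_(b < p ^ n2) dpmon i j a b *: G a b = G i j.
Proof.
move=> hi hj; rewrite (bigD1 (Ordinal hi)) //= (bigD1 (Ordinal hj)) //=.
rewrite mxE !eqxx scale1r !big1 ?addr0 // => [a|b] ne.
  apply: big1 => b _; rewrite mxE -val_eqE /= in ne *.
  by rewrite (negbTE ne) scale0r.
by rewrite mxE -val_eqE /= in ne *; rewrite (negbTE ne) andbF scale0r.
Qed.

Lemma dpmul0l f : dpmul 0 f = 0.
Proof.
rewrite /dpmul big1 // => a _; rewrite big1 // => b _; rewrite big1 // => c _.
by rewrite big1 // => d _; rewrite mxE !mul0r scale0r.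
Qed.

Lemma dpmul0r f : dpmul f 0 = 0.
Proof.
rewrite /dpmul big1 // => a _; rewrite big1 // => b _; rewrite big1 // => c _.
by rewrite big1 // => d _; rewrite mxE mulr0 mul0r scale0r.
Qed.

Lemma dpmon_mul i j k l :
  dpmul (dpmon i j) (dpmon k l)
  = ('C(i + k, i) * 'C(j + l, j))%:R *: dpmon (i + k) (j + l).
Proof.
have [out|] := boolP ((p ^ n1 <= i)%N || (p ^ n2 <= j)%N).
  rewrite dpmon_out // dpmul0l dpmon_out ?scaler0 //.
  by case/orP: out => h; rewrite (leq_trans h (leq_addr _ _)) ?orbT.
have [out|] := boolP ((p ^ n1 <= k)%N || (p ^ n2 <= l)%N).
  rewrite [dpmon k l]dpmon_out // dpmul0r dpmon_out ?scaler0 //.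
  by case/orP: out => h; rewrite (leq_trans h (leq_addl _ _)) ?orbT.
rewrite !negb_or -!ltnNge => /andP[hk hl] /andP[hi hj]; rewrite /dpmul.
under eq_bigr => a _ do under eq_bigr => b _ do
  under eq_bigr => c _ do under eq_bigr => d _ do rewrite -mulrA -scalerA -scalerA.
under eq_bigr => a _ do under eq_bigr => b _ do
  under eq_bigr => c _ do rewrite -scaler_sumr.
under eq_bigr => a _ do under eq_bigr => b _ do rewrite -scaler_sumr
  (sum_dpmon (fun c d => ('C(a + c, a) * 'C(b + d, b))%:R *: dpmon (a + c) (b + d))) //.
exact: (sum_dpmon (fun a b => ('C(a + k, a) * 'C(b + l, b))%:R *: dpmon (a + k) (b + l))).
Qed.

Lemma dpmulC : commutative dpmul.
Proof.
move=> f g; elim/dpa_ind: f => [|c f f' ef ef'|i j _ _].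
- by rewrite dpmul0l dpmul0r.
- by rewrite dpmulDl dpmulDr ef ef'.
elim/dpa_ind: g => [|c g g' eg eg'|k l _ _].
- by rewrite dpmul0l dpmul0r.
- by rewrite dpmulDl dpmulDr eg eg'.
rewrite !dpmon_mul [(k + i)%N]addnC [(l + j)%N]addnC.
by rewrite -(bin_sub (leq_addr k i)) -(bin_sub (leq_addr l j)) !addKn.
Qed.

Lemma dpmulA : associative dpmul.
Proof.
move=> f g h; elim/dpa_ind: f => [|c f f' ef ef'|i j _ _].
- by rewrite !dpmul0l.
- by rewrite !dpmulDl ef ef'.
elim/dpa_ind: g => [|c g g' eg eg'|k l _ _].
- by rewrite !(dpmul0l, dpmul0r).
- by rewrite !(dpmulDl, dpmulDr) eg eg'.
elim/dpa_ind: h => [|c h h' eh eh'|m n _ _].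
- by rewrite !(dpmul0l, dpmul0r).
- by rewrite !(dpmulDl, dpmulDr) eh eh'.
have binA a b c : ('C(b + c, b) * 'C(a + (b + c), a)
                   = 'C(a + b, a) * 'C(a + b + c, a + b))%N.
  have fac_gt0 := fact_gt0.
  apply/eqP; rewrite -(eqn_pmul2r (fac_gt0 a)) -(eqn_pmul2r (fac_gt0 b)).
  rewrite -(eqn_pmul2r (fac_gt0 c)); apply/eqP.
  have fac u v : ('C(u + v, u) * (u`! * v`!) = (u + v)`!)%N.
    by rewrite -(bin_fact (leq_addr v u)) addKn.
  transitivity ((a + b + c)`!).
    rewrite -addnA -[RHS]fac -(fac b c); ring.
  by rewrite -[LHS]fac -(fac a b); ring.
rewrite !dpmon_mul.
have Zr c u v : dpmul u (c *: v) = c *: dpmul u v.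
  by rewrite -[c *: v]addr0 dpmulDr dpmul0r addr0.
have Zl c u v : dpmul (c *: u) v = c *: dpmul u v.
  by rewrite -[c *: u]addr0 dpmulDl dpmul0l addr0.
rewrite Zr Zl !dpmon_mul !scalerA !addnA; congr (_ *: _).
by rewrite -!natrM; congr (_%:R); rewrite mulnACA -!addnA !binA addnA [RHS]mulnACA !addnA.
Qed.

Lemma dpmul1l : left_id (dpmon 0 0) dpmul.
Proof.
move=> f; elim/dpa_ind: f => [|c f g ef eg|i j _ _].
- exact: dpmul0r.
- by rewrite dpmulDr ef eg.
by rewrite dpmon_mul !bin0 scale1r.
Qed.

Lemma dpmulrDl : left_distributive dpmul +%R.
Proof. by move=> f g h; rewrite -[f in LHS]scale1r dpmulDl scale1r. Qed.

HB.instance Definition _ := GRing.Zmodule_isComPzRing.Build dpa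
  dpmulA dpmulC dpmul1l dpmulrDl.

Lemma dpa1 : 1 = dpmon 0 0 :> dpa. Proof. by []. Qed.

Lemma dpaZl (c : F) (f g : dpa) : (c *: f) * g = c *: (f * g).
Proof. by have := dpmulDl c f 0 g; rewrite dpmul0l !addr0. Qed.

Lemma dpaZr (c : F) (f g : dpa) : f * (c *: g) = c *: (f * g).
Proof. by rewrite mulrC dpaZl mulrC. Qed.

Lemma dpmonM i j k l : dpmon i j * dpmon k l
  = ('C(i + k, i) * 'C(j + l, j))%:R *: dpmon (i + k) (j + l).
Proof. exact: dpmon_mul. Qed.

Lemma dpdx_linear : linear dpdx.
Proof.
move=> c f g; rewrite /dpdx scaler_sumr -big_split; apply: eq_bigr => a _ /=.
rewrite scaler_sumr -big_split; apply: eq_bigr => b _ /=.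
by rewrite scalerA -scalerDl !mxE.
Qed.
HB.instance Definition _ := GRing.isLinear.Build F dpa dpa _ dpdx dpdx_linear.

Lemma dpdy_linear : linear dpdy.
Proof.
move=> c f g; rewrite /dpdy scaler_sumr -big_split; apply: eq_bigr => a _ /=.
rewrite scaler_sumr -big_split; apply: eq_bigr => b _ /=.
by rewrite scalerA -scalerDl !mxE.
Qed.
HB.instance Definition _ := GRing.isLinear.Build F dpa dpa _ dpdy dpdy_linear.

Lemma dpdxD f g : dpdx (f + g) = dpdx f + dpdx g.
Proof. exact: linearD. Qed.
Lemma dpdyD f g : dpdy (f + g) = dpdy f + dpdy g.
Proof. exact: linearD. Qed.
Lemma dpdxN f : dpdx (- f) = - dpdx f.
Proof. exact: linearN. Qed.
Lemma dpdyN f : dpdy (- f) = - dpdy f.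
Proof. exact: linearN. Qed.

Lemma dpdx_mon i j : (i < p ^ n1)%N ->
  dpdx (dpmon i j) = if i == 0%N then 0 else dpmon i.-1 j.
Proof.
move=> hi; have [out|hj] := leqP (p ^ n2) j.
  by rewrite !dpmon_out ?out ?orbT // linear0 if_same.
exact: (sum_dpmon (fun a b => if a == 0%N then 0 else dpmon a.-1 b)).
Qed.

Lemma dpdy_mon i j : (j < p ^ n2)%N ->
  dpdy (dpmon i j) = if j == 0%N then 0 else dpmon i j.-1.
Proof.
move=> hj; have [out|hi] := leqP (p ^ n1) i.
  by rewrite !dpmon_out ?out ?orbT // linear0 if_same.
exact: (sum_dpmon (fun a b => if b == 0%N then 0 else dpmon a b.-1)).
Qed.

Lemma dpdxy f : dpdx (dpdy f) = dpdy (dpdx f).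
Proof.
elim/dpa_ind: f => [|c f g ef eg|i j hi hj]; rewrite ?linear0 //.
  by rewrite !(dpdx_linear, dpdy_linear) ef eg.
rewrite dpdy_mon // dpdx_mon //.
case: eqP => [j0|/eqP/negbTE j0]; case: eqP => [i0|/eqP/negbTE i0]; rewrite ?linear0 //.
- by rewrite dpdy_mon // j0.
- by rewrite dpdx_mon // i0.
- have lt m n : (m < n -> m.-1 < n)%N by apply: leq_ltn_trans (leq_pred _).
  rewrite dpdx_mon // dpdy_mon //.
  by rewrite i0 j0.
Qed.

Section Characteristic.
Hypothesis pF : p \in [pchar F].

Lemma bin_pchar n i : (0 < i < p ^ n)%N -> 'C(p ^ n, i)%:R = 0 :> F.
Proof.
case/andP=> i0 ip; have pp := pcharf_prime pF.
apply/eqP; rewrite -(dvdn_pcharf pF); apply/negPn/negP => ndvd.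
have : (p ^ n %| i * 'C(p ^ n, i))%N.
  by rewrite -{2}(prednK (leq_trans i0 (ltnW ip))) -(prednK i0) -mul_bin_diag
             prednK ?dvdn_mulr // (leq_trans i0 (ltnW ip)).
rewrite Gauss_dvdl; last by rewrite coprimeXl // prime_coprime.
by move/(dvdn_leq i0); rewrite leqNgt ip.
Qed.

Lemma dpdx_bin i k m : (i < p ^ n1)%N -> (0 < i)%N -> (0 < k)%N ->
  'C(i + k, i)%:R *: dpdx (dpmon (i + k) m)
  = 'C(i + k, i)%:R *: dpmon (i + k).-1 m.
Proof.
move=> hi i0 k0; have [lt|lt|eq] := ltngtP (i + k)%N (p ^ n1).
- by rewrite dpdx_mon // addn_eq0 eqn0Ngt i0.
- have h : (p ^ n1 <= (i + k).-1)%N by case: (i + k)%N lt.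
  by rewrite !dpmon_out ?linear0 ?h ?(ltnW lt).
- by rewrite [in X in X *: _]eq [in X in _ = X *: _]eq bin_pchar ?scale0r ?i0.
Qed.

Lemma dpdy_bin j l m : (j < p ^ n2)%N -> (0 < j)%N -> (0 < l)%N ->
  'C(j + l, j)%:R *: dpdy (dpmon m (j + l))
  = 'C(j + l, j)%:R *: dpmon m (j + l).-1.
Proof.
move=> hj j0 l0; have [lt|lt|eq] := ltngtP (j + l)%N (p ^ n2).
- by rewrite dpdy_mon // addn_eq0 eqn0Ngt j0.
- have h : (p ^ n2 <= (j + l).-1)%N by case: (j + l)%N lt.
  by rewrite !dpmon_out ?linear0 ?h ?(ltnW lt) ?orbT.
- by rewrite [in X in X *: _]eq [in X in _ = X *: _]eq bin_pchar ?scale0r ?j0.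
Qed.

Lemma dpdxM f g : dpdx (f * g) = dpdx f * g + f * dpdx g.
Proof.
elim/dpa_ind: f => [|c f f' ef ef'|i j hi hj].
- by rewrite linear0 !mul0r linear0 addr0.
- rewrite mulrDl dpaZl !(dpdx_linear, dpdy_linear) ef ef' !mulrDl !dpaZl scalerDr !addrA.
  by congr (_ + _); rewrite -!addrA; congr (_ + _); rewrite addrC.
elim/dpa_ind: g => [|c g g' eg eg'|k l hk hl].
- by rewrite linear0 !mulr0 linear0 addr0.
- rewrite mulrDr dpaZr !(dpdx_linear, dpdy_linear) eg eg' !mulrDr !dpaZr scalerDr !addrA.
  by congr (_ + _); rewrite -!addrA; congr (_ + _); rewrite addrC.
rewrite dpmonM !dpdx_mon //.
have [->|i0] := posnP i.
  rewrite mul0r add0r linearZ /= add0n dpdx_mon // bin0.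
  by case: (posnP k) => [_|k0]; rewrite ?mulr0 ?scaler0 // dpmonM bin0.
have [->|k0] := posnP k.
  rewrite mulr0 addr0 linearZ /= addn0 dpdx_mon // eqn0Ngt i0 /=.
  by rewrite dpmonM addn0 !binn.
rewrite linearZ /= mulnC natrM -scalerA dpdx_bin // !dpmonM !scalerA -natrM.
case: i k i0 k0 {hi hk} => // i [|k] // _ _.
by rewrite /= addSn addnS /= -scalerDl -natrD -mulnDl binS mulnC addnC.
Qed.

Lemma dpdyM f g : dpdy (f * g) = dpdy f * g + f * dpdy g.
Proof.
elim/dpa_ind: f => [|c f f' ef ef'|i j hi hj].
- by rewrite linear0 !mul0r linear0 addr0.
- rewrite mulrDl dpaZl !(dpdx_linear, dpdy_linear) ef ef' !mulrDl !dpaZl scalerDr !addrA.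
  by congr (_ + _); rewrite -!addrA; congr (_ + _); rewrite addrC.
elim/dpa_ind: g => [|c g g' eg eg'|k l hk hl].
- by rewrite linear0 !mulr0 linear0 addr0.
- rewrite mulrDr dpaZr !(dpdx_linear, dpdy_linear) eg eg' !mulrDr !dpaZr scalerDr !addrA.
  by congr (_ + _); rewrite -!addrA; congr (_ + _); rewrite addrC.
rewrite dpmonM !dpdy_mon //.
have [->|j0] := posnP j.
  rewrite mul0r add0r linearZ /= add0n dpdy_mon // bin0.
  by case: (posnP l) => [_|l0]; rewrite ?mulr0 ?scaler0 // dpmonM bin0.
have [->|l0] := posnP l.
  rewrite mulr0 addr0 linearZ /= addn0 dpdy_mon // eqn0Ngt j0 /=.
  by rewrite dpmonM addn0 !binn.
rewrite linearZ /= natrM -scalerA dpdy_bin // !dpmonM !scalerA -natrM.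
case: j l j0 l0 {hj hl} => // j [|l] // _ _.
rewrite /= addSn addnS /= -scalerDl -natrD -mulnDr binS.
by congr ((_ * _)%:R *: _); rewrite addnC.
Qed.

End Characteristic.

End DividedPowers.

Section Hamiltonian.
Variables (F : fieldType) (p n1 n2 : nat).
Local Notation A := (dpa F p n1 n2).
Local Notation dpmon := (dpmon F p n1 n2).

(* the element e of F[2:n] *)
Definition dptop : A := dpmon (p ^ n1).-1 (p ^ n2).-1.

Definition poisson (f g : A) : A :=
  (1 + dptop) * (dpdy f * dpdx g - dpdx f * dpdy g).

(* H(2:n;omega_2) is identified with F[2:n] / <1>, with the bracket induced by
   the Poisson bracket; see hbr_pi, hbr_lie, and dham_linear, dham_eq0,
   dham_dbr and second_derived_dham for the identification with the second
   derived algebra of an algebra of derivations. *)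
Definition hamiltonian : vectType F := quotv <[1 : A]>%VS.

Definition hbr (a b : hamiltonian) : hamiltonian :=
  quot_pi _ (poisson (quot_repr a) (quot_repr b)).

Definition hmon (i j : nat) : hamiltonian := quot_pi _ (dpmon i j).

Definition hmon_index : seq (nat * nat) :=
  [seq m <- [seq (i, j) | i <- iota 0 (p ^ n1), j <- iota 0 (p ^ n2)]
     | m != (0%N, 0%N)].

(* the bilinear form on the Hamiltonian algebra with value c m m' at the
   pair of basis monomials with exponents m and m'; the constant coefficients,
   which depend on the choice of representatives, are not involved *)
Definition hform (c : nat * nat -> nat * nat -> F) : form2 hamiltonian :=
  linfun (fun a : hamiltonian => linfun (fun b : hamiltonian =>
    \sum_(i < p ^ n1) \sum_(j < p ^ n2 | (i + j != 0)%N)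
    \sum_(k < p ^ n1) \sum_(l < p ^ n2 | (k + l != 0)%N)
      quot_repr a i j * quot_repr b k l * c (val i, val j) (val k, val l) : F^o)
    : form1 hamiltonian).

(* u is congruent to w modulo the subgroup of Z^2 generated by v *)
Definition pair_cong (v u w : int * int) : Prop :=
  exists t : int, u - w = v *~ t.

Definition hmodulus : int * int :=
  ((p ^ n1)%N%:Z - 1, (p ^ n2)%N%:Z - 1).

Definition phi (r : nat) : form2 hamiltonian :=
  hform (fun m m' =>
    if `[< pair_cong hmodulus ((m.1 + m'.1)%N%:Z, (m.2 + m'.2)%N%:Z)
             (0, (p ^ r)%N%:Z) >]
    then (-1) ^+ (m.1 + m.2) else 0).

Definition psi (s : nat) : form2 hamiltonian :=
  hform (fun m m' =>
    if `[< pair_cong hmodulus ((m.1 + m'.1)%N%:Z, (m.2 + m'.2)%N%:Z)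
             ((p ^ s)%N%:Z, 0) >]
    then (-1) ^+ (m.1 + m.2 + 1) else 0).

Let hsum c (a b : hamiltonian) : F^o :=
    \sum_(i < p ^ n1) \sum_(j < p ^ n2 | (i + j != 0)%N)
    \sum_(k < p ^ n1) \sum_(l < p ^ n2 | (k + l != 0)%N)
      quot_repr a i j * quot_repr b k l * c (val i, val j) (val k, val l).

Let coefP (c : F) (f g : A) (i : 'I_(p ^ n1)) (j : 'I_(p ^ n2)) :
  (c *: f + g) i j = c * f i j + g i j.
Proof. by rewrite !mxE. Qed.

Let hreprP t (a b : hamiltonian) :
  quot_repr (t *: a + b) = t *: (quot_repr a : A) + quot_repr b.
Proof. exact: quot_reprP. Qed.

Let hsumr c a : linear (hsum c a).
Proof.
move=> t b b'; rewrite /hsum scaler_sumr -big_split; apply: eq_bigr => i _ /=.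
rewrite scaler_sumr -big_split; apply: eq_bigr => j _ /=.
rewrite scaler_sumr -big_split; apply: eq_bigr => k _ /=.
rewrite scaler_sumr -big_split; apply: eq_bigr => l _ /=.
by rewrite hreprP coefP /GRing.scale /=; ring.
Qed.

Let hsuml c b : linear (hsum c ^~ b).
Proof.
move=> t a a'; rewrite /hsum scaler_sumr -big_split; apply: eq_bigr => i _ /=.
rewrite scaler_sumr -big_split; apply: eq_bigr => j _ /=.
rewrite scaler_sumr -big_split; apply: eq_bigr => k _ /=.
rewrite scaler_sumr -big_split; apply: eq_bigr => l _ /=.
by rewrite hreprP coefP /GRing.scale /=; ring.
Qed.

Lemma hformE c a b : hform c a b = hsum c a b.
Proof.
pose H a := GRing.isLinear.Build F hamiltonian F^o _ (hsum c a) (hsumr c a).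
pose R a : {linear hamiltonian -> F^o} := HB.pack (hsum c a) (H a).
have RE x y : linfun (hsum c x) y = hsum c x y by exact: (lfunE (R x)).
have lin1 : linear (fun a => linfun (hsum c a) : form1 hamiltonian).
  move=> t x y; apply/lfunP => z.
  by rewrite add_lfunE scale_lfunE !RE; apply: hsuml.
pose H1 := GRing.isLinear.Build F hamiltonian (form1 hamiltonian) _ _ lin1.
pose R1 : {linear hamiltonian -> form1 hamiltonian} := HB.pack (fun a => linfun (hsum c a) : form1 hamiltonian) H1.
by rewrite /hform (lfunE R1) RE.
Qed.

Lemma dpdx1 : dpdx (1 : A) = 0.
Proof.
rewrite dpa1; have [h|h] := posnP (p ^ n1)%N; last by rewrite dpdx_mon.
by rewrite dpmon_out ?linear0 // h.
Qed.

Lemma dpdy1 : dpdy (1 : A) = 0.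
Proof.
rewrite dpa1; have [h|h] := posnP (p ^ n2)%N; last by rewrite dpdy_mon.
by rewrite dpmon_out ?linear0 // h orbT.
Qed.

Lemma quot_repr_pi (f : A) :
  exists c : F, quot_repr (quot_pi <[1 : A]>%VS f) = f + c *: (1 : A).
Proof.
have /vlineP[c e] := quot_pi_repr <[1 : A]>%VS f.
by exists (- c); rewrite scaleNr -e opprB addrC subrK.
Qed.

Lemma hform_mon c i j k l :
  (i < p ^ n1)%N -> (j < p ^ n2)%N -> (i, j) != (0, 0)%N ->
  (k < p ^ n1)%N -> (l < p ^ n2)%N -> (k, l) != (0, 0)%N ->
  hform c (hmon i j) (hmon k l) = c (i, j) (k, l).
Proof.
move=> hi hj nij hk hl nkl; rewrite hformE /hsum.
have monE m n (a : 'I_(p ^ n1)) (b : 'I_(p ^ n2)) : (a + b != 0)%N ->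
    quot_repr (hmon m n) a b = dpmon m n a b.
  move=> ab; have [t ->] := quot_repr_pi (dpmon m n).
  have z : dpmon 0 0 a b = 0.
    by rewrite mxE -addn_eq0 (negbTE ab).
  by rewrite dpa1 mxE [X in _ + X]mxE z mulr0 addr0.
have nz m n : ((m, n) != (0, 0)%N) = (m + n != 0)%N by rewrite addn_eq0.
rewrite !nz in nij nkl.
pose G a b m n : F^o := if (a + b != 0)%N then
  (if (m + n != 0)%N then c (a, b) (m, n) else 0) else 0.
transitivity (\sum_(a < p ^ n1) \sum_(b < p ^ n2) dpmon i j a b *:
  \sum_(m < p ^ n1) \sum_(n < p ^ n2) dpmon k l m n *: G a b m n).
  apply: eq_bigr => a _; rewrite big_mkcond; apply: eq_bigr => b _.
  rewrite /G; case: ifP => [ab|ab]; last first.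
    by rewrite big1 ?scaler0 // => m _; rewrite big1 // => n _; rewrite scaler0.
  rewrite scaler_sumr; apply: eq_bigr => m _.
  rewrite scaler_sumr big_mkcond; apply: eq_bigr => n _.
  case: ifP => mn; last by rewrite !scaler0.
  by rewrite !monE // scalerA.
rewrite (sum_dpmon (fun a b => \sum_(m < p ^ n1) \sum_(n < p ^ n2)
  dpmon k l m n *: G a b m n)) // (sum_dpmon (G i j)) //.
by rewrite /G nij nkl.
Qed.

Lemma poissonP c f g h :
  poisson (c *: f + g) h = c *: poisson f h + poisson g h.
Proof.
rewrite /poisson !(dpdx_linear, dpdy_linear) -dpaZr -mulrDr; congr (_ * _).
by rewrite !mulrDl !dpaZl scalerBr opprD addrACA.
Qed.

Lemma poissonC f g : poisson f g = - poisson g f.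
Proof. by rewrite /poisson; ring. Qed.

Lemma poissonPr c f g h :
  poisson h (c *: f + g) = c *: poisson h f + poisson h g.
Proof. by rewrite poissonC poissonP opprD -scalerN -!poissonC. Qed.

Lemma poisson1l f : poisson (1 : A) f = 0.
Proof. by rewrite /poisson dpdx1 dpdy1 !mul0r subrr mulr0. Qed.

Lemma hbr_pi (f g : A) :
  hbr (quot_pi _ f) (quot_pi _ g) = quot_pi _ (poisson f g).
Proof.
rewrite /hbr; have [c ->] := quot_repr_pi f; have [d ->] := quot_repr_pi g.
rewrite ![_ + _ *: (1 : A)]addrC poissonP poisson1l scaler0 add0r.
by rewrite poissonPr [poisson f (1 : A)]poissonC poisson1l oppr0 scaler0 add0r.
Qed.

Section Characteristic.
Hypothesis pF : p \in [pchar F].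

Lemma poisson_jacobi f g h :
  poisson (poisson f g) h + poisson (poisson g h) f + poisson (poisson h f) g
  = 0.
Proof.
rewrite /poisson !(dpdxM pF, dpdyM pF, dpdxD, dpdyD, dpdxN, dpdyN) -!dpdxy.
ring.
Qed.

Lemma hbr_lie : lie_bracket hbr.
Proof.
have E (a : hamiltonian) : a = quot_pi _ (quot_repr a) by rewrite quot_reprK.
have D t f g : t *: quot_pi <[1 : A]>%VS f + quot_pi _ g
    = quot_pi _ (t *: f + g) by rewrite linearP.
split=> [t x y z|t x y z|x|x y z].
- rewrite (E x) (E y) (E z) D !hbr_pi D; congr (quot_pi _ _).
  exact: poissonP.
- rewrite (E x) (E y) (E z) D !hbr_pi D; congr (quot_pi _ _).
  exact: poissonPr.
- rewrite (E x) hbr_pi; have -> : poisson (quot_repr x) (quot_repr x) = 0 :> A.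
    by rewrite /poisson; ring.
  exact: linear0.
rewrite (E x) (E y) (E z) !hbr_pi -!linearD /= poisson_jacobi; exact: linear0.
Qed.

Lemma expn_pchar_gt0 n : (0 < p ^ n)%N.
Proof. by rewrite expn_gt0 prime_gt0 ?(pcharf_prime pF). Qed.

Lemma hmon00 : hmon 0 0 = 0.
Proof.
have : (1 : A) \in lker (quot_pi <[1 : A]>%VS).
  by rewrite lker_quot_pi memv_line.
by rewrite memv_ker => /eqP.
Qed.

Lemma hmon_basis :
  basis_of fullv [seq hmon m.1 m.2 | m <- hmon_index].
Proof.
rewrite basisEdim; apply/andP; split.
  apply/subvP => a _; rewrite -[a]quot_reprK.
  elim/dpa_ind: (quot_repr a) => [|c f g ef eg|i j hi hj].
  - by rewrite linear0 mem0v.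
  - by rewrite linearP memvD // memvZ.
  have [[-> ->]|nij] := eqVneq (i, j) (0, 0)%N.
    by rewrite -[quot_pi _ _]/(hmon 0 0) hmon00 mem0v.
  apply/memv_span/mapP; exists (i, j) => //.
  rewrite mem_filter nij; apply/allpairsP; exists (i, j).
  by rewrite !mem_iota.
have one0 : (1 : A) != 0.
  apply/eqP => /matrixP /(_ (Ordinal (expn_pchar_gt0 n1))
                            (Ordinal (expn_pchar_gt0 n2))).
  by rewrite !mxE /= => /eqP; rewrite oner_eq0.
have -> : \dim {:hamiltonian} = (p ^ n1 * p ^ n2).-1.
  rewrite dimvf; change (\dim (<[1 : A]>^C)%VS = (p ^ n1 * p ^ n2).-1).
  by rewrite dimv_compl dimvf dim_vline one0 subn1.
set s := [seq (i, j) | i <- iota 0 (p ^ n1), j <- iota 0 (p ^ n2)].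
have us : uniq s.
  apply: allpairs_uniq; rewrite ?iota_uniq //.
  by move=> [? ?] [? ?] _ _ [-> ->].
have s0 : (0, 0)%N \in s.
  by apply/allpairsP; exists (0, 0)%N; rewrite !mem_iota !expn_pchar_gt0.
rewrite size_map size_filter -[count _ _]/(count (predC (pred1 (0, 0)%N)) s).
have := count_predC (pred1 (0, 0)%N) s.
by rewrite count_uniq_mem // s0 size_allpairs !size_iota => <-.
Qed.

End Characteristic.

End Hamiltonian.

Section Derivations.
Variables (F : fieldType) (p n1 n2 : nat).
Local Notation A := (dpa F p n1 n2).
Local Notation e := (dptop F p n1 n2).

(* the pair D stands for the derivation D.1 d/dx + D.2 d/dy *)
Implicit Types D E : A * A.

Definition dact D (h : A) : A := D.1 * dpdx h + D.2 * dpdy h.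

Definition dbr D E : A * A :=
  (dact D E.1 - dact E D.1, dact D E.2 - dact E D.2).

(* the Lie derivative is
   D(w dx /\ dy) = (D(w) + w (dD.1/dx + dD.2/dy)) dx /\ dy, here with w = 1 - e *)
Definition annihilates_omega2 D : Prop :=
  dact D (1 - e) + (1 - e) * (dpdx D.1 + dpdy D.2) = 0.

Definition derived_algebra (S : A * A -> Prop) (D : A * A) : Prop :=
  exists s : seq ((A * A) * (A * A)),
    (forall u, u \in s -> S u.1 /\ S u.2) /\ D = \sum_(u <- s) dbr u.1 u.2.

(* dham f = (1 + e) (f_y d/dx - f_x d/dy), which maps g to {f, g}; it induces
   an isomorphism from [hamiltonian] onto the second derived algebra of the Lie
   algebra of the derivations annihilating omega_2 *)
Definition dham (f : A) : A * A := ((1 + e) * dpdy f, - ((1 + e) * dpdx f)).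

Lemma dham_linear : linear dham.
Proof.
move=> c f g; rewrite /dham !(dpdx_linear, dpdy_linear).
by congr (_, _) => /=; rewrite mulrDr dpaZr // opprD scalerN.
Qed.
HB.instance Definition _ :=
  GRing.isLinear.Build F A (A * A)%type _ dham dham_linear.

Hypotheses (pF : p \in [pchar F]) (n1_gt0 : (0 < n1)%N) (n2_gt0 : (0 < n2)%N).

Let P_gt1 : (1 < p ^ n1)%N.
Proof. by rewrite -(exp1n n1) ltn_exp2r // prime_gt1 // (pcharf_prime pF). Qed.

Let Q_gt1 : (1 < p ^ n2)%N.
Proof. by rewrite -(exp1n n2) ltn_exp2r // prime_gt1 // (pcharf_prime pF). Qed.

Lemma dptop_mon i j : (i, j) != (0, 0)%N -> e * dpmon F p n1 n2 i j = 0.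
Proof.
move=> nij; rewrite /dptop dpmonM dpmon_out ?scaler0 //.
case: i nij => [|i] nij.
  case: j nij => [|j] // _; rewrite addnS -addSn prednK ?leq_addr ?orbT //.
  exact: ltnW.
by rewrite addnS -addSn prednK ?leq_addr // ltnW.
Qed.

Lemma dptop2 : e * e = 0.
Proof.
apply: dptop_mon; apply/eqP => -[h _]; move: P_gt1.
by rewrite -(prednK (ltnW P_gt1)) h.
Qed.

Lemma dact_dbr D E h :
  dact (dbr D E) h = dact D (dact E h) - dact E (dact D h).
Proof.
by rewrite /dbr /dact /= !(dpdxM pF, dpdyM pF, dpdxD, dpdyD) -!dpdxy; ring.
Qed.

Lemma dact_dham f g : dact (dham f) g = poisson f g.
Proof. by rewrite /dact /dham /poisson /=; ring. Qed.

Lemma dham_dbr f g : dbr (dham f) (dham g) = dham (poisson f g).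
Proof.
rewrite /dbr /dact /dham /poisson /=.
rewrite !(dpdxM pF, dpdyM pF, dpdxD, dpdyD, dpdxN, dpdyN, dpdx1, dpdy1) -!dpdxy.
by congr (_, _); ring.
Qed.

Lemma dham_annihilates f : annihilates_omega2 (dham f).
Proof.
have e2x : e * dpdx e + e * dpdx e = 0.
  by have := dpdxM pF e e; rewrite dptop2 linear0 [dpdx e * e]mulrC.
have e2y : e * dpdy e + e * dpdy e = 0.
  by have := dpdyM pF e e; rewrite dptop2 linear0 [dpdy e * e]mulrC.
rewrite /annihilates_omega2 /dact /dham /=.
rewrite !(dpdxM pF, dpdyM pF, dpdxD, dpdyD, dpdxN, dpdyN, dpdx1, dpdy1) -!dpdxy.
transitivity ((e * dpdy e + e * dpdy e) * dpdx f
  - (e * dpdx e + e * dpdx e) * dpdy f); first ring.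
by rewrite e2x e2y !mul0r subrr.
Qed.

Lemma dbr_annihilates D E : annihilates_omega2 D -> annihilates_omega2 E ->
  dbr D E = dham ((1 - e) * (D.2 * E.1 - D.1 * E.2)).
Proof.
rewrite /annihilates_omega2 /dbr /dham /dact.
case: D E => D1 D2 [E1 E2] /= hD hE.
rewrite !(dpdxM pF, dpdyM pF, dpdxD, dpdyD, dpdxN, dpdyN, dpdx1, dpdy1, sub0r) in hD hE *.
have u X Y : (1 - e) * X = Y -> X = (1 + e) * Y.
  move=> <-; transitivity (X - e * e * X); last ring.
  by rewrite dptop2 mul0r subr0.
congr (_, _).
  apply: u; apply/eqP; rewrite -subr_eq0; apply/eqP.
  transitivity (D1 * 0 - E1 * 0 : A); last by rewrite !mulr0 subr0.
  by rewrite -{1}hE -hD; ring.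
rewrite -mulrN; apply: u; apply/eqP; rewrite -subr_eq0; apply/eqP.
transitivity (D2 * 0 - E2 * 0 : A); last by rewrite !mulr0 subr0.
by rewrite -{1}hE -hD; ring.
Qed.

Let derivedW (S T : A * A -> Prop) D :
  (forall E, S E -> T E) -> derived_algebra S D -> derived_algebra T D.
Proof.
by move=> ST [s [sS ->]]; exists s; split=> // u /sS[? ?]; split; apply: ST.
Qed.

Let is_dham D := exists f, D = dham f.

Let dham1 : dham 1 = 0.
Proof. by rewrite /dham dpdx1 dpdy1 mulr0 oppr0. Qed.

Let derived1 : forall D, derived_algebra annihilates_omega2 D -> is_dham D.
Proof.
move=> _ [s [sS ->]]; elim: s sS => [|u s IH] sS.
  by exists 0; rewrite big_nil linear0.
have [f ef] : is_dham (\sum_(v <- s) dbr v.1 v.2).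
  by apply: IH => v vs; apply: sS; rewrite inE vs orbT.
have [hu1 hu2] := sS u (mem_head _ _).
rewrite big_cons ef (dbr_annihilates hu1 hu2) -linearD.
by eexists.
Qed.

Let derived_dham D : is_dham D -> derived_algebra is_dham D.
Proof.
case=> f ->; elim/dpa_ind: f => [|c f g [s [sH ef]] [t [tH eg]]|i j hi hj].
- by exists [::]; rewrite big_nil linear0.
- exists ([seq (c *: u.1, u.2) | u <- s] ++ t); split=> [u|].
    rewrite mem_cat => /orP[/mapP[v /sH[[v1 e1] [v2 e2]] ->]|/tH//].
    split; last by exists v2.
    by exists (c *: v1); rewrite /= e1 linearZ.
  rewrite dham_linear ef eg big_cat big_map scaler_sumr /=; congr (_ + _).
  apply: eq_bigr => u _; rewrite /dbr /dact /=.
  have Z (v : A) : dpdx (c *: v) = c *: dpdx v by exact: linearZ.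
  have Zy (v : A) : dpdy (c *: v) = c *: dpdy v by exact: linearZ.
  by rewrite !(Z, Zy, dpaZl, dpaZr) -!scalerDr -!scalerBr.
have [[-> ->]|nij] := eqVneq (i, j) (0, 0)%N.
  by exists [::]; rewrite big_nil -dpa1 dham1.
suff [g [h E]] : exists g h, dham (poisson g h) = dham (dpmon F p n1 n2 i j).
  exists [:: (dham g, dham h)]; split=> [u|].
    by rewrite inE => /eqP->; split; eexists.
  by rewrite big_seq1 /= dham_dbr E.
have one_e : (1 + e) * dpmon F p n1 n2 i j = dpmon F p n1 n2 i j.
  by rewrite mulrDl mul1r dptop_mon // addr0.
have dxx : dpdx (dpmon F p n1 n2 1 0) = 1 by rewrite dpdx_mon.
have dyx : dpdy (dpmon F p n1 n2 1 0) = 0 by rewrite dpdy_mon // ltnW.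
have dxy : dpdx (dpmon F p n1 n2 0 1) = 0 by rewrite dpdx_mon // ltnW.
have dyy : dpdy (dpmon F p n1 n2 0 1) = 1 by rewrite dpdy_mon.
have [hi'|hi'] := ltnP i.+1 (p ^ n1).
  exists (dpmon F p n1 n2 0 1), (dpmon F p n1 n2 i.+1 j).
  by rewrite /poisson dxy dyy mul0r subr0 mul1r dpdx_mon //= one_e.
have [hj'|hj'] := ltnP j.+1 (p ^ n2).
  exists (dpmon F p n1 n2 i j.+1), (dpmon F p n1 n2 1 0).
  by rewrite /poisson dxx dyx mulr0 subr0 mulr1 dpdy_mon //= one_e.
exists (dpmon F p n1 n2 0 1), (dpmon F p n1 n2 1 0).
rewrite /poisson dxx dyx dxy dyy mul0r subr0 !mulr1 linearD /= dham1 add0r.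
have mx m n : (m < n -> n <= m.+1 -> n.-1 = m)%N.
  by move=> mn nm; have -> : n = m.+1 by apply/eqP; rewrite eqn_leq nm.
by rewrite /dptop (mx i) // (mx j).
Qed.

Let coef_dpdx (f : A) (a a' : 'I_(p ^ n1)) b :
  (a = a'.+1 :> nat) -> dpdx f a' b = f a b.
Proof.
move=> aa'; elim/dpa_ind: f => [|c f g ef eg|i j hi hj].
- by rewrite linear0 !mxE.
- by rewrite dpdx_linear mxE [in LHS]mxE ef eg [in RHS]mxE [in RHS]mxE.
by rewrite dpdx_mon //; case: i hi => [|i] hi; rewrite !mxE aa'.
Qed.

Let coef_dpdy (f : A) a (b b' : 'I_(p ^ n2)) :
  (b = b'.+1 :> nat) -> dpdy f a b' = f a b.
Proof.
move=> bb'; elim/dpa_ind: f => [|c f g ef eg|i j hi hj].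
- by rewrite linear0 !mxE.
- by rewrite dpdy_linear mxE [in LHS]mxE ef eg [in RHS]mxE [in RHS]mxE.
by rewrite dpdy_mon //; case: j hj => [|j] hj; rewrite !mxE bb' /= ?andbF.
Qed.

Lemma dham_eq0 f : dham f = 0 <-> f \in <[1 : A]>%VS.
Proof.
split=> [[hy hx]|/vlineP[c ->]]; last by rewrite linearZ /= dham1 scaler0.
have u X : (1 + e) * X = 0 -> X = 0.
  move=> h; transitivity ((1 - e) * ((1 + e) * X)); last by rewrite h mulr0.
  transitivity (X - e * e * X); last ring.
  by rewrite dptop2 mul0r subr0.
have {}hy := u _ hy; have {}hx : dpdx f = 0.
  by apply: u; rewrite -[LHS]opprK hx oppr0.
pose i0 := Ordinal (ltnW P_gt1); pose j0 := Ordinal (ltnW Q_gt1).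
apply/vlineP; exists (f i0 j0); apply/matrixP => a b.
rewrite dpa1 !mxE; case: eqP => [a0|/eqP a0] /=; last first.
  have ha : (a.-1 < p ^ n1)%N by apply: leq_ltn_trans (leq_pred _) _.
  rewrite -(@coef_dpdx f a (Ordinal ha)) ?hx ?mxE ?mulr0 //=.
  by rewrite prednK // lt0n.
case: eqP => [b0|/eqP b0] /=; last first.
  have hb : (b.-1 < p ^ n2)%N by apply: leq_ltn_trans (leq_pred _) _.
  rewrite -(@coef_dpdy f a b (Ordinal hb)) ?hy ?mxE ?mulr0 //=.
  by rewrite prednK // lt0n.
by rewrite mulr1; congr (f _ _); apply: val_inj.
Qed.

Lemma second_derived_dham D :
  derived_algebra (derived_algebra annihilates_omega2) D <->
  exists f, D = dham f.
Proof.
have dham2 E : is_dham E -> derived_algebra annihilates_omega2 E.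
  by move/derived_dham; apply: derivedW => _ [f ->]; apply: dham_annihilates.
split=> [|/derived_dham]; last by apply: derivedW => E /dham2.
move=> h; apply: derived1; apply: derivedW h => E /derived1[f ->].
exact: dham_annihilates.
Qed.

End Derivations.

(* Main.v *)
Require Import Defs.
From HB Require Import structures.
From mathcomp Require Import all_boot all_order all_algebra ring zify.
From mathcomp Require Import boolp.

(* Put x = x^(1), y = y^(1), P = p^n1, Q = p^n2.  Up to signs, ad x and ad y
   lower one exponent of a monomial by 1, where x^(0) y^(0) has to be read as e.
   In particular [y, x] = e, so x and y generate L, and a cocycle theta is
   determined by theta(x, .) and theta(y, .).

   Cocycles.  The symmetric form kappa(f, g) = coefficient of e in (1 - e) f g is
   invariant for the Poisson bracket.  As p is odd, the derivation
   D = (ad z)^(p^r) is skew for kappa, hence kappa(D a, b) is a cocycle.  For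
   z = x and z = -y these are the phi_r and the - psi_s.

   Generation.  Subtracting a coboundary, one may assume that
   theta(x, x^(k) y^(l)) = 0 for l > 0 and theta(y, x^(k) y^(Q-1)) = 0 for k > 0.
   The cocycle identity gives theta(x^(i), x^(k)) = C(i+k-1, i-1) theta(x, x^(i+k-1)),
   and skewness then C(m+1, i) theta(x, x^(m)) = 0 for 0 < i <= m, so that
   theta(x, x^(m)) = 0 unless m + 1 is a power of p; likewise for theta(y, y^(m)).
   These values are matched by the psi_s and the phi_r.  Once they vanish,
   theta(x, .) = 0, and the cocycle identity for y, x^(i) and a monomial forces
   theta(y, .) = 0, so theta = 0.

   Independence.  phi_r and psi_s are detected by their values on the commuting
   pairs (y, y^(p^r-1)) and (x, x^(p^s-1)), where coboundaries vanish. *)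

Set Implicit Arguments.
Unset Strict Implicit.
Unset Printing Implicit Defensive.

Import Order.TTheory GRing.Theory Num.Theory.
Local Open Scope ring_scope.

(** * Binomial coefficients in characteristic [p] *)

Section Binomials.
Variables (F : fieldType) (p : nat).
Hypothesis pF : p \in [pchar F].

(** Pascal's rule and the vanishing of [C(p^n, i+1)] give [C(p^n - 1, i+1) = - C(p^n - 1, i)]. *)
Lemma bin_pred_pchar n i : (i < p ^ n)%N -> 'C((p ^ n).-1, i)%:R = (-1) ^+ i :> F.
Proof.
have q0 : (0 < p ^ n)%N := expn_pchar_gt0 pF n.
elim: i => [|i IH] hi; first by rewrite bin0.
have := bin_pchar pF (n := n) (i := i.+1); rewrite hi => /(_ isT).
rewrite -{1}(prednK q0) binS natrD IH 1?ltnW // exprS mulN1r.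
by move/eqP; rewrite addr_eq0 => /eqP.
Qed.

(** Write [N = m q] with [q = p^r] and [m] prime to [p]. In [(X + 1)^N = (X^q + 1)^m] the
    coefficients of [X^q] are [C(N, q)] and [m]; for [m > 1] the first would be zero and the second
    is not. *)
Lemma pchar_pow_of_bin0 N : (1 < N)%N ->
  (forall i, (0 < i < N)%N -> 'C(N, i)%:R = 0 :> F) ->
  exists2 r, (0 < r)%N & N = (p ^ r)%N.
Proof.
move=> N_gt1 C0; have pp := pcharf_prime pF.
have N0 : (0 < N)%N by apply: ltnW.
have [m pm eN] := pfactor_coprime pp N0.
set r := logn p N in eN *; set q := (p ^ r)%N in eN *.
have q0 : (0 < q)%N by rewrite expn_gt0 prime_gt0.
have m0 : m%:R != 0 :> F.
  by rewrite -(dvdn_pcharf pF) -prime_coprime.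
suff m1 : m = 1%N.
  rewrite {}m1 mul1n in eN; exists r => //.
  by rewrite lt0n; apply/eqP => r0; move: N_gt1; rewrite eN /q r0.
apply/eqP; rewrite eqn_leq; apply/andP; split; last first.
  by case: m m0 {pm eN}; rewrite ?eqxx.
rewrite leqNgt; apply/negP => m_gt1.
have cP : p \in [pchar {poly F}] by rewrite pchar_poly.
have q_nat : [pchar {poly F}].-nat q.
  by apply/pnatP => // l lp; rewrite /q Euclid_dvdX // => /andP[/(prime_nt_dvdP pp)->]//;
     move: lp; case: (l) => [|[]].
have E : ('X + 1) ^+ N = ('X^q + 1) ^+ m :> {poly F}.
  by rewrite eN mulnC exprM exprDn_pchar // expr1n.
have := congr1 (fun u : {poly F} => u`_q) E.
rewrite !exprD1n !coef_sum.
have qN : (q < N)%N by rewrite eN -{1}[q]mul1n ltn_pmul2r.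
have q1 : (q < N.+1)%N by apply: ltnW.
rewrite (bigD1 (Ordinal q1)) //= big1 => [|i ne]; last first.
  rewrite coefMn coefXn; case: eqP => [qi|]; last by rewrite mul0rn.
  by move/eqP: ne; case; apply: val_inj.
rewrite coefMn coefXn eqxx addr0 C0 ?q0 //.
have m1 : (1 < m.+1)%N by apply: ltnW.
rewrite (bigD1 (Ordinal m1)) //= big1 => [|i ne]; last first.
  rewrite coefMn -exprM coefXn; case: eqP => [qi|]; last by rewrite mul0rn.
  move/eqP: ne; case; apply: val_inj => /=; apply/eqP.
  by rewrite -(eqn_pmul2l q0) muln1 -qi.
rewrite coefMn expr1 coefXn eqxx addr0 bin1 => /esym/eqP.
by rewrite (negbTE m0).
Qed.

End Binomials.

(** * The invariant form [kappa] *)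

Section InvariantForm.
Variables (F : fieldType) (p n1 n2 : nat).
Hypotheses (pF : p \in [pchar F]) (p_odd : odd p).
Hypotheses (n1_gt0 : (0 < n1)%N) (n2_gt0 : (0 < n2)%N).

Local Notation A := (dpa F p n1 n2).
Local Notation P := (p ^ n1)%N.
Local Notation Q := (p ^ n2)%N.
Local Notation mon := (dpmon F p n1 n2).
Local Notation e := (dptop F p n1 n2).
Local Notation L := (hamiltonian F p n1 n2).

Lemma odd_pchar_gt2 : (2 < p)%N.
Proof. by rewrite odd_prime_gt2 // (pcharf_prime pF). Qed.

Lemma expn_pchar_gt2 n : (0 < n)%N -> (2 < p ^ n)%N.
Proof.
move=> n0; apply: leq_trans odd_pchar_gt2 _.
by rewrite -{1}[p]expn1 leq_exp2l // ltnW // odd_pchar_gt2.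
Qed.

Lemma two_neq0 : 2%:R != 0 :> F.
Proof.
rewrite -(dvdn_pcharf pF); apply/negP => /(@dvdn_leq p 2 isT).
by rewrite leqNgt odd_pchar_gt2.
Qed.

Let ltP : (P.-1 < P)%N. Proof. by rewrite prednK // (expn_pchar_gt0 pF). Qed.
Let ltQ : (Q.-1 < Q)%N. Proof. by rewrite prednK // (expn_pchar_gt0 pF). Qed.

Definition ctop (f : A) : F := f (Ordinal ltP) (Ordinal ltQ).

Lemma ctopP c f g : ctop (c *: f + g) = c * ctop f + ctop g.
Proof. by rewrite /ctop !mxE. Qed.

Lemma ctopD f g : ctop (f + g) = ctop f + ctop g.
Proof. by rewrite /ctop !mxE. Qed.

Lemma ctopN f : ctop (- f) = - ctop f.
Proof. by rewrite /ctop !mxE. Qed.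

Lemma ctop0 : ctop 0 = 0.
Proof. by rewrite /ctop !mxE. Qed.

Lemma ctop_mon i j : ctop (mon i j) = ((i == P.-1) && (j == Q.-1))%:R.
Proof. by rewrite /ctop mxE /= eq_sym [X in _ && X]eq_sym. Qed.

Lemma ctop_dpdx f : ctop (dpdx f) = 0.
Proof.
elim/dpa_ind: f => [|c f g ef eg|i j hi hj].
- by rewrite linear0 ctop0.
- by rewrite dpdx_linear ctopP ef eg mulr0 addr0.
rewrite dpdx_mon //; case: eqP => i0; rewrite ?ctop0 // ctop_mon.
by case: eqP => //=; lia.
Qed.

Lemma ctop_dpdy f : ctop (dpdy f) = 0.
Proof.
elim/dpa_ind: f => [|c f g ef eg|i j hi hj].
- by rewrite linear0 ctop0.
- by rewrite dpdy_linear ctopP ef eg mulr0 addr0.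
rewrite dpdy_mon //; case: eqP => i0; rewrite ?ctop0 // ctop_mon.
by case: eqP => //= _; case: eqP => //=; lia.
Qed.

(* the factor [1 - e] cancels the factor [1 + e] of the Poisson bracket *)
Definition kappa (f g : A) : F := ctop ((1 - e) * f * g).

Lemma kappaC f g : kappa f g = kappa g f.
Proof. by rewrite /kappa; congr ctop; ring. Qed.

Lemma kappaPl c f g h : kappa (c *: f + g) h = c * kappa f h + kappa g h.
Proof. by rewrite /kappa mulrDr mulrDl dpaZr dpaZl ctopP. Qed.

Lemma kappaPr c f g h : kappa h (c *: f + g) = c * kappa h f + kappa h g.
Proof. by rewrite !(kappaC h) kappaPl. Qed.

Lemma kappa0l f : kappa 0 f = 0.
Proof. by rewrite /kappa mulr0 mul0r ctop0. Qed.

Lemma kappa0r f : kappa f 0 = 0.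
Proof. by rewrite kappaC kappa0l. Qed.

Lemma kappaDl f g h : kappa (f + g) h = kappa f h + kappa g h.
Proof. by rewrite -[f]scale1r kappaPl mul1r scale1r. Qed.

Lemma kappaNl f h : kappa (- f) h = - kappa f h.
Proof. by rewrite -[- f]addr0 -scaleN1r kappaPl kappa0l addr0 mulN1r. Qed.

(* up to the factor [1 + e], [{f, g} h - f {g, h}] is a divergence, and
   derivatives have no component along [e] *)
Lemma kappa_poisson f g h : kappa (poisson f g) h = kappa f (poisson g h).
Proof.
have e2 : e * e = 0 by exact: dptop2.
have E u v : (1 - e) * ((1 + e) * u) * v = u * v.
  transitivity (u * v - e * e * (u * v)); first ring.
  by rewrite e2 mul0r subr0.
rewrite [RHS]kappaC /kappa /poisson !E; apply/eqP; rewrite -subr_eq0.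
rewrite -ctopN -ctopD.
have -> : (dpdy f * dpdx g - dpdx f * dpdy g) * h -
          (dpdy g * dpdx h - dpdx g * dpdy h) * f
        = dpdy (f * dpdx g * h) + dpdx (- (f * dpdy g * h)).
  by rewrite dpdxN !(dpdxM pF, dpdyM pF) -dpdxy; ring.
by rewrite ctopD ctop_dpdx ctop_dpdy addr0.
Qed.

(** The factor [1 - e] fixes a nonconstant monomial, and the product has top coefficient
    [C(P-1, i) C(Q-1, j)], which is a sign. *)
Lemma kappa_mon i j k l : (i < P)%N -> (j < Q)%N -> (i, j) != (0, 0)%N ->
  kappa (mon i j) (mon k l) =
  if ((i + k == P.-1) && (j + l == Q.-1))%N then (-1) ^+ (i + j) else 0.
Proof.
move=> hi hj nij; rewrite /kappa mulrBl mul1r dptop_mon // subr0 dpmonM.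
rewrite -[_ *: _]addr0 ctopP ctop0 addr0 ctop_mon.
case: eqP => [->|]; rewrite ?mulr0 //=; case: eqP => [->|]; rewrite ?mulr0 //=.
by rewrite mulr1 natrM !bin_pred_pchar // exprD.
Qed.

(** Serves the case where a bracket lowers a monomial to the constant one and so produces
    [1 + e]. *)
Lemma kappa_1e_mon k l : (k < P)%N -> (l < Q)%N -> (k, l) != (0, 0)%N ->
  kappa (1 + e) (mon k l) = ((k == P.-1) && (l == Q.-1))%:R.
Proof.
move=> hk hl nkl; rewrite /kappa -ctop_mon; congr ctop.
transitivity (mon k l - e * e * mon k l); first ring.
by rewrite dptop2 // mul0r subr0.
Qed.

(** * Powers of an inner derivation, and the cocycles they define *)

Section Derivation.
Variable z : A.
Local Notation D := (poisson z).

Lemma poissonZ c (f g : A) : poisson f (c *: g) = c *: poisson f g.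
Proof. by rewrite -[c *: g]addr0 poissonPr /poisson !linear0 !mulr0 subr0 mulr0 addr0. Qed.

Lemma poissonDr (f g h : A) : poisson f (g + h) = poisson f g + poisson f h.
Proof. by rewrite -[g]scale1r poissonPr !scale1r. Qed.

Lemma poisson0r (f : A) : poisson f 0 = 0.
Proof. by rewrite /poisson !linear0 !mulr0 subr0 mulr0. Qed.

Lemma poissonNr (f g : A) : poisson f (- g) = - poisson f g.
Proof. by rewrite -scaleN1r poissonZ scaleN1r. Qed.

Lemma poisson_der f g : D (poisson f g) = poisson (D f) g + poisson f (D g).
Proof.
have := poisson_jacobi pF z f g.
rewrite [poisson (poisson f g) z]poissonC [poisson (poisson g z) f]poissonC.
rewrite [poisson g z]poissonC poissonNr opprK => /eqP.
by rewrite addrAC subr_eq0 => /eqP <-.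
Qed.

Lemma iter_poissonP n c f g :
  iter n D (c *: f + g) = c *: iter n D f + iter n D g.
Proof. by elim: n => //= n ->; rewrite poissonPr. Qed.

Lemma iter_poisson0 n : iter n D 0 = 0.
Proof. by elim: n => //= n ->; rewrite poisson0r. Qed.

Lemma iter_poisson1 n : (0 < n)%N -> iter n D 1 = 0.
Proof.
by case: n => // n _; rewrite iterSr poissonC poisson1l oppr0 iter_poisson0.
Qed.

Lemma iter_poisson_leibniz n f g :
  iter n D (poisson f g) =
  \sum_(i < n.+1) 'C(n, i)%:R *: poisson (iter (n - i) D f) (iter i D g).
Proof.
elim: n => [|n IH]; first by rewrite big_ord1 bin0 scale1r.
rewrite [LHS]/= {}IH (big_morph D (poissonDr z) (poisson0r z)).
under eq_bigr do rewrite poissonZ poisson_der scalerDr.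
rewrite big_split /=.
pose G i := poisson (iter (n.+1 - i) D f) (iter i D g).
have -> : \sum_(i < n.+1) 'C(n, i)%:R *:
    poisson (D (iter (n - i) D f)) (iter i D g)
  = \sum_(i < n.+2) 'C(n, i)%:R *: G i.
  rewrite [RHS]big_ord_recr /= bin_small // scale0r addr0.
  by apply: eq_bigr => i _; rewrite /G subSn // -ltnS.
(* The shifted sum receives a zero coefficient at [i = 0], so that both sums have the same range and
   merge by Pascal's rule. *)
have -> : \sum_(i < n.+1) 'C(n, i)%:R *:
    poisson (iter (n - i) D f) (D (iter i D g))
  = \sum_(i < n.+2) (if i == 0 :> nat then 0 else 'C(n, i.-1))%:R *: G i.
  by rewrite [RHS]big_ord_recl /= scale0r add0r.
rewrite -big_split; apply: eq_bigr => -[[|i] hi] _ /=.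
  by rewrite !bin0 scale0r addr0.
by rewrite -scalerDl -natrD -binS.
Qed.

(** In the Leibniz formula the inner coefficients [C(p^r, i)] vanish in characteristic [p]. *)
Lemma iter_poisson_der r f g :
  iter (p ^ r) D (poisson f g) =
  poisson (iter (p ^ r) D f) g + poisson f (iter (p ^ r) D g).
Proof.
rewrite iter_poisson_leibniz big_ord_recl /=.
have q0 : (0 < p ^ r)%N := expn_pchar_gt0 pF r.
case: (p ^ r)%N q0 (@bin_pchar F p pF r) => // q _ C0.
rewrite big_ord_recr /= big1 ?add0r => [|i _]; last first.
  by rewrite C0 ?scale0r //= /bump /= add1n ltnS ltn_ord.
by rewrite bin0 !scale1r /bump /= add1n subnn binn scale1r.
Qed.

Lemma kappa_der f g : kappa (D f) g = - kappa f (D g).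
Proof. by rewrite poissonC kappaNl kappa_poisson. Qed.

Lemma kappa_iter n f g : kappa (iter n D f) g = (-1) ^+ n * kappa f (iter n D g).
Proof.
elim: n f g => [|n IH] f g; first by rewrite mul1r.
by rewrite [in LHS]iterS kappa_der IH exprS -mulrA mulN1r -iterSr.
Qed.

(** As [p^r] is odd, the derivation [D^(p^r)] is skew for [kappa]. Skewness and symmetry give
    [2 kappa(D^(p^r) f, f) = 0]; the Leibniz rule, skewness and invariance cancel the cyclic sum. *)
Lemma hform_kappa_cocycle (c : nat * nat -> nat * nat -> F) (s : F) r :
  (forall f g, hform p n1 n2 c (quot_pi _ f) (quot_pi _ g) =
               s * kappa (iter (p ^ r) D f) g) ->
  is_cocycle2 (@hbr F p n1 n2) (hform p n1 n2 c).
Proof.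
move=> cE; have E (a : L) : a = quot_pi _ (quot_repr a) by rewrite quot_reprK.
have skew f g : kappa (iter (p ^ r) D f) g = - kappa f (iter (p ^ r) D g).
  by rewrite kappa_iter -signr_odd oddX p_odd orbT expr1 mulN1r.
split=> [a|a b d].
  rewrite (E a) cE; set f := quot_repr a.
  have /eqP := skew f f.
  rewrite [in X in _ == X]kappaC -addr_eq0 -mulr2n -mulr_natl mulf_eq0.
  by rewrite (negbTE two_neq0) => /eqP ->; rewrite mulr0.
rewrite (E a) (E b) (E d) !hbr_pi !cE.
set f := quot_repr a; set g := quot_repr b; set h := quot_repr d.
rewrite -!mulrDr iter_poisson_der kappaDl (skew (poisson g h)) (skew (poisson h f)).
rewrite (kappa_poisson (iter _ _ f)) [kappa (poisson f _) h]kappaC.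
rewrite -(kappa_poisson h f) [kappa (poisson g h) _]kappaC.
by rewrite -addrA -opprD subrr mulr0.
Qed.

End Derivation.

End InvariantForm.

(** * The forms [phi] and [psi] are cocycles *)

Lemma small_multiple (M N u v : nat) (t : int) : (v < N.*2)%N ->
  u%:Z = M%:Z * t -> v%:Z = N%:Z * t -> (u = 0 /\ v = 0)%N \/ (u = M /\ v = N).
Proof.
move=> hv eu ev; have N0 : 0 < N%:Z by lia.
have t0 : 0 <= t by rewrite -(pmulr_rge0 _ N0) -ev.
have t2 : t < 2 by rewrite -(ltr_pM2l N0) -ev; lia.
have [t'|t'] : t = 0 \/ t = 1 by lia.
  by left; rewrite t' !mulr0 in eu ev; lia.
by right; rewrite t' !mulr1 in eu ev; lia.
Qed.

Section Cocycles.
Variables (F : fieldType) (p n1 n2 : nat).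
Hypotheses (pF : p \in [pchar F]) (p_odd : odd p).
Hypotheses (n1_gt0 : (0 < n1)%N) (n2_gt0 : (0 < n2)%N).

Local Notation A := (dpa F p n1 n2).
Local Notation P := (p ^ n1)%N.
Local Notation Q := (p ^ n2)%N.
Local Notation mon := (dpmon F p n1 n2).
Local Notation e := (dptop F p n1 n2).
Local Notation L := (hamiltonian F p n1 n2).
Local Notation kappa := (kappa pF).

Let P_gt2 : (2 < P)%N. Proof. exact: expn_pchar_gt2 pF p_odd _ n1_gt0. Qed.
Let Q_gt2 : (2 < Q)%N. Proof. exact: expn_pchar_gt2 pF p_odd _ n2_gt0. Qed.
Let oddP : odd P. Proof. by rewrite oddX p_odd orbT. Qed.
Let oddQ : odd Q. Proof. by rewrite oddX p_odd orbT. Qed.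

Lemma mul1e_mon i j : (i, j) != (0, 0)%N -> (1 + e) * mon i j = mon i j.
Proof. by move=> nij; rewrite mulrDl mul1r dptop_mon // addr0. Qed.

Lemma poisson_x f : poisson (mon 1 0) f = - ((1 + e) * dpdy f).
Proof.
have h1 : (1 < P)%N by apply: ltnW.
rewrite /poisson dpdx_mon // dpdy_mon ?(expn_pchar_gt0 pF) //=.
by rewrite -dpa1 mul0r sub0r mul1r mulrN.
Qed.

Lemma poisson_y f : poisson (mon 0 1) f = (1 + e) * dpdx f.
Proof.
have h1 : (1 < Q)%N by apply: ltnW.
rewrite /poisson dpdy_mon // dpdx_mon ?(expn_pchar_gt0 pF) //=.
by rewrite -dpa1 mul0r subr0 mul1r.
Qed.

Lemma pair_congP i j k l a b :
  `[< pair_cong (hmodulus p n1 n2) ((i + k)%N%:Z, (j + l)%N%:Z) (a%:Z, b%:Z) >]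
  <-> exists t : int, (i + k)%N%:Z - a%:Z = P.-1%:Z * t /\
                      (j + l)%N%:Z - b%:Z = Q.-1%:Z * t.
Proof.
have E (t : int) : hmodulus p n1 n2 *~ t = (P.-1%:Z * t, Q.-1%:Z * t).
  have -> : hmodulus p n1 n2 = (P.-1%:Z, Q.-1%:Z) by congr (_, _); lia.
  rewrite [LHS]surjective_pairing.
  by rewrite (raddfMz fst) (raddfMz snd) /= -!mulrzz.
split=> [/asboolP[t]|[t [h1 h2]]]; last apply/asboolP.
  by rewrite E => -[h1 h2]; exists t.
by exists t; rewrite E -h1 -h2.
Qed.

Lemma poissonNl (f g : A) : poisson (- f) g = - poisson f g.
Proof. by rewrite poissonC poissonNr -poissonC. Qed.

Let sgnPQ : (-1) ^+ (P.-1 + Q.-1) = 1 :> F.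
Proof. by rewrite -signr_odd oddD -!subn1 !oddB ?oddP ?oddQ // ltnW // ltnW. Qed.

Lemma iter_poissonN (z f : A) n : iter n (poisson z) (- f) = - iter n (poisson z) f.
Proof. by rewrite -[- f]addr0 -scaleN1r iter_poissonP iter_poisson0 addr0 scaleN1r. Qed.

Lemma iter_poisson1D (z f : A) n : (0 < n)%N ->
  iter n (poisson z) (1 + f) = iter n (poisson z) f.
Proof. by move=> n0; rewrite -[1]scale1r iter_poissonP iter_poisson1 // scaler0 add0r. Qed.

(** Induction on [n]: [ad x] sends [x^(i) y^(j)] to [- (1 + e) x^(i) y^(j-1)], which changes the
    sign and lowers both sides of the congruence by 1 in the second component. *)
Lemma kappa_iter_x n i j k l :
  (i < P)%N -> (j < Q)%N -> (i, j) != (0, 0)%N ->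
  (k < P)%N -> (l < Q)%N -> (k, l) != (0, 0)%N -> (0 < n)%N ->
  kappa (iter n (poisson (mon 1 0)) (mon i j)) (mon k l) =
  if `[< pair_cong (hmodulus p n1 n2) ((i + k)%N%:Z, (j + l)%N%:Z)
                   (0%N%:Z, n%:Z) >]
  then (-1) ^+ (i + j) else 0.
Proof.
move=> hi hj nij hk hl nkl; case: n => // n _.
(* With [y]-exponent 0, a multiple [t > 0] would force [l >= Q]; hence [t = 0] and [i' + k = 0]. *)
have c0 i' m : `[< pair_cong (hmodulus p n1 n2) ((i' + k)%N%:Z, (0 + l)%N%:Z)
                   (0%N%:Z, m.+1%:Z) >] -> i' = 0%N.
  move=> /pair_congP[t [h1 h2]]; case: (lerP t 0) => ht; last by nia.
  by nia.
elim: n i j hi hj nij => [|n IH] i [|j] hi hj nij;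
  rewrite iterSr poisson_x dpdy_mon //= -?iterS.
- rewrite mulr0 oppr0 kappa0l; case: ifP => // /c0 i0; by rewrite i0 in nij.
- have [[i0 j0]|nij'] := eqVneq (i, j) (0, 0)%N.
    rewrite i0 j0 -dpa1 mulr1 kappaNl kappa_1e_mon //.
    have -> : `[< pair_cong (hmodulus p n1 n2) ((0 + k)%N%:Z, (1 + l)%N%:Z)
                   (0%N%:Z, 1%N%:Z) >] = (k == P.-1) && (l == Q.-1).
      apply/idP/andP => [/pair_congP[t [h1 h2]]|[/eqP h1 /eqP h2]].
        (* The second exponent is below [2 (Q - 1)], which leaves only the multiples 0 and 1 of the
           modulus; 0 contradicts [nkl]. *)
        have [[k0 l0]|[-> ->]//] : (k = 0 /\ l = 0)%N \/ (k = P.-1 /\ l = Q.-1).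
          by apply: (@small_multiple _ _ _ _ t); lia.
        by rewrite k0 l0 in nkl.
      by apply/pair_congP; exists 1; split; lia.
    by case: ifP; rewrite ?oppr0.
  rewrite mul1e_mon // kappaNl kappa_mon //; last by apply: ltnW.
  have -> : `[< pair_cong (hmodulus p n1 n2) ((i + k)%N%:Z, (j.+1 + l)%N%:Z)
                 (0%N%:Z, 1%N%:Z) >] = (i + k == P.-1)%N && (j + l == Q.-1)%N.
    apply/idP/andP => [/pair_congP[t [h1 h2]]|[/eqP h1 /eqP h2]].
      have [[k0 l0]|[-> ->]//] :
          (i + k = 0 /\ j + l = 0)%N \/ (i + k = P.-1 /\ j + l = Q.-1)%N.
        by apply: (@small_multiple _ _ _ _ t); lia.
      by move: nkl; rewrite xpair_eqE; lia.
    by apply/pair_congP; exists 1; split; lia.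
  by case: ifP; rewrite ?oppr0 // addnS exprS mulN1r.
- rewrite mulr0 oppr0 iter_poisson0 kappa0l; case: ifP => // /c0 i0; by rewrite i0 in nij.
rewrite iter_poissonN kappaNl.
have [[i0 j0]|nij'] := eqVneq (i, j) (0, 0)%N.
  (* The result is [1 + e]. The next bracket kills 1, and [e] has degree [(P - 1, Q - 1)]: the
     congruence class is that of [(0, 0)], and the sign is unchanged because [P - 1] and [Q - 1] are
     even. *)
  rewrite i0 j0 -dpa1 mulr1 iter_poisson1D // IH //; try lia.
    have -> : `[< pair_cong (hmodulus p n1 n2) ((P.-1 + k)%N%:Z, (Q.-1 + l)%N%:Z)
                   (0%N%:Z, n.+1%:Z) >] =
             `[< pair_cong (hmodulus p n1 n2) ((0 + k)%N%:Z, (1 + l)%N%:Z)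
                   (0%N%:Z, n.+2%:Z) >].
      apply/idP/idP => /pair_congP[t [h1 h2]]; apply/pair_congP.
        by exists (t - 1); split; lia.
      by exists (t + 1); split; lia.
    by case: ifP; rewrite ?oppr0 // sgnPQ.
  by apply/eqP => -[]; lia.
rewrite mul1e_mon // IH //; last by apply: ltnW.
have -> : `[< pair_cong (hmodulus p n1 n2) ((i + k)%N%:Z, (j.+1 + l)%N%:Z)
                   (0%N%:Z, n.+2%:Z) >] =
         `[< pair_cong (hmodulus p n1 n2) ((i + k)%N%:Z, (j + l)%N%:Z)
                   (0%N%:Z, n.+1%:Z) >].
   apply/idP/idP => /pair_congP[t [h1 h2]]; apply/pair_congP; exists t; split; lia.
by case: ifP; rewrite ?oppr0 // addnS exprS mulN1r.
Qed.

(** The mirror image of [kappa_iter_x]; [- y] is used because [ad y] lowers exponents without the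
    sign of [ad x]. *)
Lemma kappa_iter_y n i j k l :
  (i < P)%N -> (j < Q)%N -> (i, j) != (0, 0)%N ->
  (k < P)%N -> (l < Q)%N -> (k, l) != (0, 0)%N -> (0 < n)%N ->
  kappa (iter n (poisson (- mon 0 1)) (mon i j)) (mon k l) =
  if `[< pair_cong (hmodulus p n1 n2) ((i + k)%N%:Z, (j + l)%N%:Z)
                   (n%:Z, 0%N%:Z) >]
  then (-1) ^+ (i + j) else 0.
Proof.
move=> hi hj nij hk hl nkl; case: n => // n _.
have c0 i' m : `[< pair_cong (hmodulus p n1 n2) ((0 + k)%N%:Z, (i' + l)%N%:Z)
                   (m.+1%:Z, 0%N%:Z) >] -> i' = 0%N.
  move=> /pair_congP[t [h1 h2]]; case: (lerP t 0) => ht; last by nia.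
  by nia.
elim: n i j hi hj nij => [|n IH] [|i] j hi hj nij;
  rewrite iterSr poissonNl poisson_y dpdx_mon //= -?iterS.
- rewrite mulr0 oppr0 kappa0l; case: ifP => // /c0 j0; by rewrite j0 in nij.
- have [[i0 j0]|nij'] := eqVneq (i, j) (0, 0)%N.
    rewrite i0 j0 -dpa1 mulr1 kappaNl kappa_1e_mon //.
    have -> : `[< pair_cong (hmodulus p n1 n2) ((1 + k)%N%:Z, (0 + l)%N%:Z)
                   (1%N%:Z, 0%N%:Z) >] = (k == P.-1) && (l == Q.-1).
      apply/idP/andP => [/pair_congP[t [h1 h2]]|[/eqP h1 /eqP h2]].
        have [[l0 k0]|[-> ->]//] : (l = 0 /\ k = 0)%N \/ (l = Q.-1 /\ k = P.-1).
          by apply: (@small_multiple Q.-1 P.-1 _ _ t); lia.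
        by rewrite k0 l0 in nkl.
      by apply/pair_congP; exists 1; split; lia.
    by case: ifP; rewrite ?oppr0.
  rewrite mul1e_mon // kappaNl kappa_mon //; last by apply: ltnW.
  have -> : `[< pair_cong (hmodulus p n1 n2) ((i.+1 + k)%N%:Z, (j + l)%N%:Z)
                 (1%N%:Z, 0%N%:Z) >] = (i + k == P.-1)%N && (j + l == Q.-1)%N.
    apply/idP/andP => [/pair_congP[t [h1 h2]]|[/eqP h1 /eqP h2]].
      have [[l0 k0]|[-> ->]//] :
          (j + l = 0 /\ i + k = 0)%N \/ (j + l = Q.-1 /\ i + k = P.-1)%N.
        by apply: (@small_multiple Q.-1 P.-1 _ _ t); lia.
      by move: nkl; rewrite xpair_eqE; lia.
    by apply/pair_congP; exists 1; split; lia.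
  by case: ifP; rewrite ?oppr0 // addSn exprS mulN1r.
- rewrite mulr0 oppr0 iter_poisson0 kappa0l; case: ifP => // /c0 j0; by rewrite j0 in nij.
rewrite iter_poissonN kappaNl.
have [[i0 j0]|nij'] := eqVneq (i, j) (0, 0)%N.
  rewrite i0 j0 -dpa1 mulr1 iter_poisson1D // IH //; try lia.
    have -> : `[< pair_cong (hmodulus p n1 n2) ((P.-1 + k)%N%:Z, (Q.-1 + l)%N%:Z)
                   (n.+1%:Z, 0%N%:Z) >] =
             `[< pair_cong (hmodulus p n1 n2) ((1 + k)%N%:Z, (0 + l)%N%:Z)
                   (n.+2%:Z, 0%N%:Z) >].
      apply/idP/idP => /pair_congP[t [h1 h2]]; apply/pair_congP.
        by exists (t - 1); split; lia.
      by exists (t + 1); split; lia.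
    by case: ifP; rewrite ?oppr0 // sgnPQ.
  by apply/eqP => -[]; lia.
rewrite mul1e_mon // IH //; last by apply: ltnW.
have -> : `[< pair_cong (hmodulus p n1 n2) ((i.+1 + k)%N%:Z, (j + l)%N%:Z)
                   (n.+2%:Z, 0%N%:Z) >] =
         `[< pair_cong (hmodulus p n1 n2) ((i + k)%N%:Z, (j + l)%N%:Z)
                   (n.+1%:Z, 0%N%:Z) >].
   apply/idP/idP => /pair_congP[t [h1 h2]]; apply/pair_congP; exists t; split; lia.
by case: ifP; rewrite ?oppr0 // addSn exprS mulN1r.
Qed.

Lemma hform_piE (c : nat * nat -> nat * nat -> F) (g : A -> A -> F) :
  (forall i j k l, (i < P)%N -> (j < Q)%N -> (i, j) != (0, 0)%N ->
    (k < P)%N -> (l < Q)%N -> (k, l) != (0, 0)%N ->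
    c (i, j) (k, l) = g (mon i j) (mon k l)) ->
  (forall h, linear (g h : A -> F^o)) -> (forall h, linear (g^~ h : A -> F^o)) ->
  (forall h, g h 1 = 0) -> (forall h, g 1 h = 0) ->
  forall u v, hform p n1 n2 c (quot_pi _ u) (quot_pi _ v) = g u v.
Proof.
move=> cg gr gl gr1 gl1 u v.
have g0r h : g h 0 = 0.
  by have := gr h (-1) 0 0; rewrite scaler0 addr0 scaleN1r addNr.
have g0l h : g 0 h = 0.
  by have := gl h (-1) 0 0; rewrite scaler0 addr0 scaleN1r addNr.
elim/dpa_ind: u => [|t u u' eu eu'|i j hi hj].
- by rewrite g0l !linear0 zero_lfunE.
- by rewrite (gl v t u u') linearP linearP add_lfunE scale_lfunE eu eu'.
elim/dpa_ind: v => [|t v v' ev ev'|k l hk hl].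
- by rewrite g0r !linear0.
- by rewrite (gr (mon i j) t v v') (linearP (quot_pi _)) linearP /= ev ev'.
have [[-> ->]|nij] := eqVneq (i, j) (0, 0)%N.
  by rewrite (hmon00 F p n1 n2 : quot_pi _ (mon 0 0) = 0) linear0 zero_lfunE -dpa1 gl1.
have [[-> ->]|nkl] := eqVneq (k, l) (0, 0)%N.
  by rewrite (hmon00 F p n1 n2 : quot_pi _ (mon 0 0) = 0) linear0 -dpa1 gr1.
by rewrite -cg //; apply: hform_mon.
Qed.

(** [kappa] does not descend to the quotient by constants, since [kappa 1 e = 1]. The form
    [kappa(D^(p^r) f, g)] does: [D] kills 1 and moves across [kappa] up to sign. *)
Lemma hform_iter_cocycle (c : nat * nat -> nat * nat -> F) (s : F) (z : A) r :
  (forall i j k l, (i < P)%N -> (j < Q)%N -> (i, j) != (0, 0)%N ->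
    (k < P)%N -> (l < Q)%N -> (k, l) != (0, 0)%N ->
    c (i, j) (k, l) = s * kappa (iter (p ^ r) (poisson z) (mon i j)) (mon k l)) ->
  is_cocycle2 (@hbr F p n1 n2) (hform p n1 n2 c).
Proof.
move=> cE; have q0 : (0 < p ^ r)%N := expn_pchar_gt0 pF r.
apply: (hform_kappa_cocycle (pF := pF) p_odd n1_gt0 n2_gt0 (z := z) (s := s)
  (r := r)) => f g.
apply: (hform_piE (g := fun u v => s * kappa (iter (p ^ r) (poisson z) u) v))
  => [|h t u v|h t u v|h|h] //=.
- by rewrite kappaPr /GRing.scale /=; ring.
- by rewrite iter_poissonP kappaPl /GRing.scale /=; ring.
- by rewrite kappa_iter // iter_poisson1 // kappa0r !mulr0.
- by rewrite iter_poisson1 // kappa0l mulr0.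
Qed.

Lemma phi_cocycle r : is_cocycle2 (@hbr F p n1 n2) (phi F p n1 n2 r).
Proof.
apply: (@hform_iter_cocycle _ 1 (mon 1 0) r) => i j k l hi hj nij hk hl nkl.
by rewrite mul1r kappa_iter_x ?(expn_pchar_gt0 pF).
Qed.

Lemma psi_cocycle s : is_cocycle2 (@hbr F p n1 n2) (psi F p n1 n2 s).
Proof.
apply: (@hform_iter_cocycle _ (-1) (- mon 0 1) s) => i j k l hi hj nij hk hl nkl.
rewrite kappa_iter_y ?(expn_pchar_gt0 pF) //= mulN1r.
by case: ifP; rewrite ?oppr0 // addn1 exprS mulN1r.
Qed.

End Cocycles.

(** * Brackets of monomials *)

Section Spanning.
Variables (F : fieldType) (p n1 n2 : nat).
Hypotheses (pF : p \in [pchar F]) (p_odd : odd p).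
Hypotheses (n1_gt0 : (0 < n1)%N) (n2_gt0 : (0 < n2)%N).

Local Notation A := (dpa F p n1 n2).
Local Notation P := (p ^ n1)%N.
Local Notation Q := (p ^ n2)%N.
Local Notation mon := (dpmon F p n1 n2).
Local Notation e := (dptop F p n1 n2).
Local Notation L := (hamiltonian F p n1 n2).
Local Notation hmon := (hmon F p n1 n2).
Local Notation br := (@hbr F p n1 n2).

Let P_gt2 : (2 < P)%N. Proof. exact: expn_pchar_gt2 pF p_odd _ n1_gt0. Qed.
Let Q_gt2 : (2 < Q)%N. Proof. exact: expn_pchar_gt2 pF p_odd _ n2_gt0. Qed.
Let P_gt1 : (1 < P)%N. Proof. exact: ltnW. Qed.
Let Q_gt1 : (1 < Q)%N. Proof. exact: ltnW. Qed.
Let P_gt0 : (0 < P)%N. Proof. exact: ltnW. Qed.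
Let Q_gt0 : (0 < Q)%N. Proof. exact: ltnW. Qed.

(* the exponent [(0, 0)] stands for [e], which has the same degree modulo
   [(P - 1, Q - 1)]; with this convention brackets with [x] and [y] are shifts *)
Definition hmon_deg (i j : nat) : L :=
  if (i, j) == (0, 0)%N then hmon P.-1 Q.-1 else hmon i j.

Lemma hmon_deg_neq0 i j : (i, j) != (0, 0)%N -> hmon_deg i j = hmon i j.
Proof. by rewrite /hmon_deg => /negbTE ->. Qed.

Let pi_1e i j : quot_pi <[1 : A]>%VS ((1 + e) * mon i j) = hmon_deg i j.
Proof.
rewrite /hmon_deg; case: eqP => [[-> ->]|/eqP nij].
  rewrite -dpa1 mulr1 linearD /= [X in X + _ = _](_ : _ = 0) ?add0r //.
  exact: hmon00.
by rewrite mul1e_mon.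
Qed.

Lemma hbr_xS k l : (l.+1 < Q)%N -> br (hmon 1 0) (hmon k l.+1) = - hmon_deg k l.
Proof. by move=> hl; rewrite hbr_pi (poisson_x pF) // dpdy_mon // linearN /= pi_1e. Qed.

Lemma hbr_x0 k : br (hmon 1 0) (hmon k 0) = 0.
Proof. by rewrite hbr_pi (poisson_x pF) // dpdy_mon // mulr0 oppr0 linear0. Qed.

Lemma hbr_yS k l : (k.+1 < P)%N -> br (hmon 0 1) (hmon k.+1 l) = hmon_deg k l.
Proof. by move=> hk; rewrite hbr_pi (poisson_y pF) // dpdx_mon //= pi_1e. Qed.

Lemma hbr_y0 l : br (hmon 0 1) (hmon 0 l) = 0.
Proof. by rewrite hbr_pi (poisson_y pF) // dpdx_mon // mulr0 linear0. Qed.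

Lemma hbr_xpow i k l : (i.+1 < P)%N -> (l.+1 < Q)%N -> (i + k, l)%N != (0, 0)%N ->
  br (hmon i.+1 0) (hmon k l.+1) = - ('C(i + k, i)%:R *: hmon (i + k) l).
Proof.
move=> hi hl nkl; rewrite hbr_pi /poisson !dpdy_mon ?Q_gt0 //=.
rewrite mul0r sub0r dpdx_mon //= dpmonM bin0 muln1 add0n mulrN dpaZr mul1e_mon //.
by rewrite linearN linearZ.
Qed.

Lemma hbr_ypow j k l : (j.+1 < Q)%N -> (k.+1 < P)%N -> (k, j + l)%N != (0, 0)%N ->
  br (hmon 0 j.+1) (hmon k.+1 l) = 'C(j + l, j)%:R *: hmon k (j + l).
Proof.
move=> hj hk nkl; rewrite hbr_pi /poisson !dpdx_mon ?P_gt0 //=.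
rewrite mul0r subr0 dpdy_mon //= dpmonM bin0 mul1n add0n dpaZr mul1e_mon //.
by rewrite linearZ.
Qed.

Lemma hbrC a b : br a b = - br b a.
Proof.
have [Dl Dr alt _] := hbr_lie n1 n2 pF.
have := alt (1 *: a + b); rewrite Dl !Dr !alt !scale1r addr0 add0r.
by move/eqP; rewrite addr_eq0 => /eqP.
Qed.

Lemma hmon_ext (V : vectType F) (f g : 'Hom(L, V)) :
  (forall i j, (i < P)%N -> (j < Q)%N -> f (hmon i j) = g (hmon i j)) -> f = g.
Proof.
move=> E; apply/lfunP => a; rewrite -[a]quot_reprK.
elim/dpa_ind: (quot_repr a) => [|c u v eu ev|i j hi hj]; last exact: E.
- by rewrite !linear0.
- by rewrite (linearP (quot_pi _)) !linearP /= eu ev.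
Qed.

Section Form2.
Implicit Type theta : form2 L.

Lemma form2Nl theta a b : theta (- a) b = - theta a b.
Proof. by rewrite linearN opp_lfunE. Qed.

Lemma form2Zr theta c a b : theta a (c *: b) = c * theta a b.
Proof. by rewrite linearZ. Qed.

End Form2.

(** * Values of a cocycle on powers of [x] and of [y] *)

Section Cocycle.
Variable theta : form2 L.
Hypothesis theta_cocycle : is_cocycle2 br theta.
Local Notation x := (hmon 1 0).
Local Notation y := (hmon 0 1).

Lemma cocycleC a b : theta a b = - theta b a.
Proof.
have [alt _] := theta_cocycle.
have := alt (a + b); rewrite !linearD /= !add_lfunE !alt addr0 add0r.
by move/eqP; rewrite addrC addr_eq0 => /eqP.
Qed.

Lemma cocycle_der z a b : theta (br z a) b + theta a (br z b) = theta z (br a b).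
Proof.
have [_ /(_ z a b)] := theta_cocycle.
rewrite [theta (br a b) z]cocycleC [br b z]hbrC form2Nl.
rewrite [theta (br z b) a]cocycleC opprK.
by move/eqP; rewrite addrAC subr_eq0 => /eqP.
Qed.

(** The cocycle identity for [x], [x^(i+1)] and [x^(k+1) y]: here [x] commutes with [x^(i+1)] and
    lowers [x^(k+1) y] to [- x^(k+1)]. *)
Lemma cocycle_xpow i k : (i.+1 < P)%N ->
  theta (hmon i.+1 0) (hmon k.+1 0) =
  'C(i + k.+1, i)%:R * theta x (hmon (i + k.+1) 0).
Proof.
move=> hi; have := cocycle_der x (hmon i.+1 0) (hmon k.+1 1).
rewrite hbr_x0 linear0 zero_lfunE add0r hbr_xS // hmon_deg_neq0 //.
rewrite hbr_xpow ?addnS // !linearN /= form2Zr.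
by move/oppr_inj.
Qed.

Lemma cocycle_ypow j l : (j.+1 < Q)%N ->
  theta (hmon 0 j.+1) (hmon 0 l.+1) =
  'C(j + l.+1, j)%:R * theta y (hmon 0 (j + l.+1)).
Proof.
move=> hj; have := cocycle_der y (hmon 0 j.+1) (hmon 1 l.+1).
rewrite hbr_y0 linear0 zero_lfunE add0r hbr_yS // hmon_deg_neq0 //.
by rewrite hbr_ypow ?addnS // form2Zr.
Qed.

(** [T i k] is meant as the value of a cocycle on the divided powers of exponents [i+1] and [k+1].
    Skewness gives [(C(n, i) + C(n, i+1)) t = 0], so every inner [C(n+1, i+1)] vanishes. *)
Lemma bin_skew_pow (n : nat) (t : F) (T : nat -> nat -> F) : (0 < n)%N -> t != 0 ->
  (forall i k, (i + k.+1 = n)%N -> T i k = 'C(n, i)%:R * t) ->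
  (forall i k, T i k = - T k i) ->
  exists2 r, (0 < r)%N & n.+1 = (p ^ r)%N.
Proof.
move=> n0 t0 ET skew; apply: (pchar_pow_of_bin0 pF) => [|i]; first by rewrite ltnS.
case: i => // i /andP[_ hi]; apply/eqP; rewrite -(mulIr_eq0 _ (mulIf t0)).
have [k en] : exists k, (i + k.+1 = n)%N by exists (n - i).-1; lia.
have /eqP := skew i k; rewrite !ET //; last by lia.
have -> : 'C(n, k) = 'C(n, i.+1).
  have kn : (k <= n)%N by lia.
  by rewrite -(bin_sub kn); congr 'C(_, _); lia.
by rewrite -addr_eq0 -mulrDl -natrD addnC -binS.
Qed.

Lemma cocycle_xx_pow k : (0 < k < P)%N -> theta x (hmon k 0) != 0 ->
  exists2 s, (0 < s <= n1)%N & k.+1 = (p ^ s)%N.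
Proof.
move=> /andP[k0 hk] t0.
have [|i j|s s0 ks] :=
  @bin_skew_pow _ _ (fun i j => theta (hmon i.+1 0) (hmon j.+1 0)) k0 t0.
- by move=> i j ij; rewrite cocycle_xpow ?ij //; lia.
- exact: cocycleC.
exists s => //; rewrite s0 -(leq_exp2l _ _ (prime_gt1 (pcharf_prime pF))).
by rewrite -ks.
Qed.

Lemma cocycle_yy_pow l : (0 < l < Q)%N -> theta y (hmon 0 l) != 0 ->
  exists2 r, (0 < r <= n2)%N & l.+1 = (p ^ r)%N.
Proof.
move=> /andP[l0 hl] t0.
have [|i j|s s0 ks] :=
  @bin_skew_pow _ _ (fun i j => theta (hmon 0 i.+1) (hmon 0 j.+1)) l0 t0.
- by move=> i j ij; rewrite cocycle_ypow ?ij //; lia.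
- exact: cocycleC.
exists s => //; rewrite s0 -(leq_exp2l _ _ (prime_gt1 (pcharf_prime pF))).
by rewrite -ks.
Qed.

(** * A cocycle normalised on [x] and [y] is zero *)

Section Rigidity.
Hypothesis theta_x : forall b, theta x b = 0.

Lemma cocycle_adx a b : theta (br x a) b = - theta a (br x b).
Proof. by have /eqP := cocycle_der x a b; rewrite theta_x addr_eq0 => /eqP. Qed.

(** The second argument lies in the image of [ad x], which is skew for [theta] and kills [x^(i)]. *)
Lemma cocycle_xpow_low i k l : (l.+1 < Q)%N -> theta (hmon i 0) (hmon_deg k l) = 0.
Proof.
move=> hl; apply: oppr_inj; rewrite oppr0 -linearN -hbr_xS //.
by apply: oppr_inj; rewrite -cocycle_adx hbr_x0 linear0 zero_lfunE oppr0.
Qed.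

Lemma cocycle_y_xpow i k l : (0 < i)%N -> (i.+1 < P)%N -> (l.+1 < Q)%N ->
  theta (hmon i 0) (hmon k l.+1) + theta (hmon i.+1 0) (br y (hmon k l.+1)) =
  - ('C(i + k, i)%:R * theta y (hmon (i + k) l)).
Proof.
move=> i0 hi hl; have := cocycle_der y (hmon i.+1 0) (hmon k l.+1).
rewrite hbr_yS // hmon_deg_neq0; last by case: i i0 {hi}.
rewrite hbr_xpow ?linearN /= ?form2Zr //.
by case: i i0 {hi}.
Qed.

Hypothesis theta_y0 : forall l, (l < Q)%N -> theta y (hmon 0 l) = 0.
Hypothesis theta_yQ : forall k, (k.+1 < P)%N -> theta y (hmon k.+1 Q.-1) = 0.

Let hmonS k l : hmon_deg k l.+1 = hmon k l.+1.
Proof. by rewrite hmon_deg_neq0 // xpair_eqE andbF. Qed.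

Lemma theta_y_low k l : (k.+1 < P)%N -> (l.+2 < Q)%N -> theta y (hmon k.+1 l) = 0.
Proof.
move=> hk hl.
(* Both terms on the left of [cocycle_y_xpow] vanish by [cocycle_xpow_low]. *)
have main i k' : (0 < i)%N -> (i.+1 < P)%N -> (k' < P)%N ->
    'C(i + k', i)%:R * theta y (hmon (i + k') l) = 0.
  move=> i0 hi hk'; apply: oppr_inj; rewrite oppr0 -cocycle_y_xpow //; last exact: ltnW.
  rewrite -hmonS cocycle_xpow_low // add0r hmonS.
  case: k' hk' => [|k'] hk'; first by rewrite hbr_y0 linear0.
  by rewrite hbr_yS // cocycle_xpow_low.
have [hk2|hk2] := ltnP k.+2 P.
  by have := main k.+1 0%N isT hk2; rewrite addn0 binn mul1r; apply; apply: ltnW.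
(* The exponent [P - 1] is too large to be taken as [i]; it is split as [1 + (P - 2)], with
   coefficient [C(P-1, 1) = -1]. *)
have := main 1%N k isT P_gt2 (ltnW hk); rewrite add1n bin1.
rewrite (_ : k.+1 = P.-1); last by lia.
move/eqP; rewrite mulf_eq0 => /orP[|/eqP//].
rewrite -[X in X%:R == 0]bin1 bin_pred_pchar //.
by rewrite expr1 oppr_eq0 oner_eq0.
Qed.

(** In the cocycle identity for [y], [x] and [e], the bracket [[y, x]] is [e] itself, and
    [theta(e, e) = 0]. *)
Lemma theta_y_top : theta y (hmon P.-1 Q.-2) = 0.
Proof.
have [alt _] := theta_cocycle.
have := cocycle_der y x (hmon P.-1 Q.-1).
rewrite theta_x addr0 hbr_yS // /hmon_deg eqxx alt.
have -> : Q.-1 = Q.-2.+1 by lia.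
rewrite hbr_xS; last by lia.
rewrite hmon_deg_neq0; last by rewrite xpair_eqE; lia.
by rewrite linearN => /esym/eqP; rewrite oppr_eq0 => /eqP.
Qed.

(* eliminating [theta (x^(i)) (x^(n-i) y^(Q-1))] for [i = 1, .., n] from
   [cocycle_y_xpow] leaves the alternating sum of the ['C(n, i)], [0 < i <= n] *)
Lemma theta_y_alternating n : (0 < n)%N -> (n.+1 < P)%N -> theta y (hmon n Q.-2) = 0.
Proof.
move=> n0 hn; set u := theta _ _; have hQ : Q.-1 = Q.-2.+1 by lia.
(* The value 0 at [i = n + 1] matches the bracket of [y] with [y^(Q-1)], which is zero. *)
pose W i := if (i <= n)%N then theta (hmon i 0) (hmon (n - i) Q.-1) else 0.
have step i : (0 < i <= n)%N -> W i + W i.+1 = - ('C(n, i)%:R * u).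
  case/andP=> i0 hi; have := @cocycle_y_xpow i (n - i) Q.-2 i0.
  rewrite subnKC // -/u => <- //; try lia.
  rewrite /W hi hQ; congr (_ + _); case: ltnP => hi'; last first.
    by rewrite (_ : (n - i = 0)%N) ?hbr_y0 ?linear0 //; lia.
  rewrite (_ : (n - i = (n - i.+1).+1)%N); last by lia.
  by rewrite hbr_yS ?hmonS //; lia.
have WE i : (i <= n)%N -> W i.+1 = - (('C(n.-1, i)%:R - (-1) ^+ i) * u).
  elim: i => [|i IH] hi; first by rewrite /W n0 theta_x bin0 subrr mul0r oppr0.
  have := step i.+1; rewrite hi IH ?(ltnW hi) // => /(_ isT) /eqP.
  rewrite addrC subr_eq -(prednK n0) binS natrD exprS => /eqP ->.
  by rewrite /=; ring.
(* At [i = n] the left side is 0 and [C(n-1, n) = 0], so that only a sign times [u] remains. *)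
have := WE n (leqnn n); rewrite /W ltnn bin_small ?prednK // sub0r mulNr opprK.
by move/esym/eqP; rewrite mulf_eq0 signr_eq0 => /eqP.
Qed.

Lemma theta_y b : theta y b = 0.
Proof.
rewrite (@hmon_ext _ (theta y) 0) ?zero_lfunE // => k l hk hl; rewrite zero_lfunE.
case: k hk => [|k] hk; first exact: theta_y0.
have [hl2|] := ltnP l.+2 Q; first exact: theta_y_low.
rewrite leq_eqVlt => /orP[/eqP hQ|hQ]; last first.
  by rewrite (_ : l = Q.-1) ?theta_yQ //; lia.
rewrite (_ : l = Q.-2); last by lia.
have [|hk2] := ltnP k.+2 P; first exact: theta_y_alternating.
by rewrite (_ : k.+1 = P.-1) ?theta_y_top //; lia.
Qed.

(* the radical of a cocycle is a subalgebra, and [x], [y] generate the algebra *)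
Lemma cocycle_eq0 : theta = 0.
Proof.
have radB a b : (forall c, theta a c = 0) -> (forall c, theta b c = 0) ->
    forall c, theta (br a b) c = 0.
  by move=> ra rb c; have := cocycle_der a b c; rewrite ra rb addr0.
(* Descent from [[y, x] = e]: [x] lowers the second exponent and [y] the first. Truncated
   subtraction makes the steps below exponent 0 trivial. *)
have rad i j c : theta (hmon_deg (P.-1 - i) (Q.-1 - j)) c = 0.
  elim: i c => [|i IHi].
    elim: j => [|j IHj] c.
      have := radB _ _ theta_y theta_x c; rewrite hbr_yS // !subn0.
      by rewrite [in X in _ -> X]hmon_deg_neq0 // xpair_eqE; lia.
    have [hj|hj] := ltnP j Q.-1;
      last by have := IHj c; rewrite (_ : Q.-1 - j.+1 = Q.-1 - j)%N //; lia.
    have := radB _ _ theta_x IHj c.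
    rewrite (_ : Q.-1 - j = (Q.-1 - j.+1).+1)%N ?hmonS; last by lia.
    rewrite hbr_xS ?form2Nl; last by lia.
    by move/eqP; rewrite oppr_eq0 => /eqP.
  move=> c; have [hi|hi] := ltnP i P.-1;
    last by have := IHi c; rewrite (_ : P.-1 - i.+1 = P.-1 - i)%N //; lia.
  have := radB _ _ theta_y IHi c.
  rewrite (_ : P.-1 - i = (P.-1 - i.+1).+1)%N; last by lia.
  by rewrite [hmon_deg _.+1 _]hmon_deg_neq0 // hbr_yS //; lia.
apply: hmon_ext => i j hi hj; apply/lfunP => c; rewrite !zero_lfunE.
have := rad (P.-1 - i)%N (Q.-1 - j)%N c; rewrite !subKn; try lia.
rewrite /hmon_deg; case: eqP => // -[-> ->] _.
by rewrite (hmon00 F p n1 n2) linear0 zero_lfunE.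
Qed.

End Rigidity.
End Cocycle.
End Spanning.

(** * Linear independence, and values of [phi] and [psi] on [x] and [y] *)

Lemma free_dual (K : fieldType) (V : vectType K) (I : eqType) (s : seq I)
    (v : I -> V) (E : I -> 'Hom(V, K^o)) : uniq s ->
  (forall i, i \in s -> E i (v i) != 0) ->
  (forall i j, i \in s -> j \in s -> i != j -> E i (v j) = 0) ->
  free [seq v i | i <- s].
Proof.
elim: s => [|i s IH] /= us Ed En; first exact: nil_free.
have /andP[is_ us'] := us; rewrite free_cons IH //; last first.
- by move=> j k js ks; apply: En; rewrite inE ?js ?ks orbT.
- by move=> j js; apply: Ed; rewrite inE js orbT.
rewrite andbT; apply/negP => h.
(* If [v i] were in the span of the other vectors, [E i] would vanish on it. *)
have : (<<[seq v i | i <- s]>> <= lker (E i))%VS.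
  apply/span_subvP => _ /mapP[j js ->]; rewrite memv_ker En ?inE ?eqxx ?js ?orbT //.
  by apply: contraNneq is_ => ->.
by move/subvP/(_ _ h); rewrite memv_ker (negbTE (Ed i _)) // inE eqxx.
Qed.

Section Basis.
Variables (F : fieldType) (p n1 n2 : nat).
Hypotheses (pF : p \in [pchar F]) (p_odd : odd p).
Hypotheses (n1_gt0 : (0 < n1)%N) (n2_gt0 : (0 < n2)%N).

Local Notation P := (p ^ n1)%N.
Local Notation Q := (p ^ n2)%N.
Local Notation L := (hamiltonian F p n1 n2).
Local Notation hmon := (hmon F p n1 n2).
Local Notation br := (@hbr F p n1 n2).
Local Notation x := (hmon 1 0).
Local Notation y := (hmon 0 1).
Local Notation phi := (phi F p n1 n2).
Local Notation psi := (psi F p n1 n2).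

Let P_gt2 : (2 < P)%N. Proof. exact: expn_pchar_gt2 pF p_odd _ n1_gt0. Qed.
Let Q_gt2 : (2 < Q)%N. Proof. exact: expn_pchar_gt2 pF p_odd _ n2_gt0. Qed.
Let P_gt1 : (1 < P)%N. Proof. exact: ltnW. Qed.
Let Q_gt1 : (1 < Q)%N. Proof. exact: ltnW. Qed.
Let P_gt0 : (0 < P)%N. Proof. exact: ltnW. Qed.
Let Q_gt0 : (0 < Q)%N. Proof. exact: ltnW. Qed.

Let congP := pair_congP pF p_odd n1_gt0 n2_gt0.

(** Since [1 + k > 0], the congruence needs a positive multiple [t] of the modulus, and then
    [l = p^r + (Q - 1) t] is out of range. Hence only the [psi] contribute to values on [x]. *)
Lemma phi_x r b : (0 < r)%N -> phi r x b = 0.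
Proof.
move=> r0; have q2 := expn_pchar_gt2 pF p_odd r0.
rewrite (@hmon_ext _ _ _ _ _ (phi r x) 0) ?zero_lfunE // => k l hk hl; rewrite zero_lfunE.
have [[-> ->]|nkl] := eqVneq (k, l) (0, 0)%N; first by rewrite (hmon00 F p n1 n2) linear0.
rewrite [LHS]hform_mon //=; case: ifP => // /(congP 1 0 k l 0 (p ^ r))[t [h1 h2]].
by case: (lerP t 0) => ht; nia.
Qed.

Lemma phi_y r k l : (0 < r)%N -> (k < P)%N -> (l < Q)%N ->
  phi r y (hmon k l) = - ((k == 0) && (l.+1 == p ^ r))%N%:R.
Proof.
move=> r0 hk hl; have q2 := expn_pchar_gt2 pF p_odd r0.
have [[-> ->]|nkl] := eqVneq (k, l) (0, 0)%N.
  by rewrite (hmon00 F p n1 n2) linear0 (_ : 1%N == _ = false) ?andbF ?oppr0 //; lia.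
rewrite [LHS]hform_mon //=.
set B := `[< _ >]; have -> : B = ((k == 0) && (l.+1 == p ^ r))%N.
  apply/idP/andP => [/(congP 0 1 k l 0 (p ^ r))[t [h1 h2]]|[/eqP h1 /eqP h2]].
    (* A positive [t] would make [l] at least [Q]; a negative one would make [k] negative. *)
    have t0 : t <= 0 by nia.
    have [k0 t0'] : (k = 0)%N /\ t = 0 by nia.
    by rewrite t0' in h2; lia.
  by apply/(congP 0 1 k l 0 (p ^ r)); exists 0; lia.
by case: ifP; rewrite ?oppr0 // expr1.
Qed.

Lemma psi_y s b : (0 < s)%N -> psi s y b = 0.
Proof.
move=> r0; have q2 := expn_pchar_gt2 pF p_odd r0.
rewrite (@hmon_ext _ _ _ _ _ (psi s y) 0) ?zero_lfunE // => k l hk hl; rewrite zero_lfunE.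
have [[-> ->]|nkl] := eqVneq (k, l) (0, 0)%N; first by rewrite (hmon00 F p n1 n2) linear0.
rewrite [LHS]hform_mon //=; case: ifP => // /(congP 0 1 k l (p ^ s) 0)[t [h1 h2]].
by case: (lerP t 0) => ht; nia.
Qed.

Lemma psi_x s k l : (0 < s)%N -> (k < P)%N -> (l < Q)%N ->
  psi s x (hmon k l) = ((l == 0) && (k.+1 == p ^ s))%N%:R.
Proof.
move=> r0 hk hl; have q2 := expn_pchar_gt2 pF p_odd r0.
have [[-> ->]|nkl] := eqVneq (k, l) (0, 0)%N.
  by rewrite (hmon00 F p n1 n2) linear0 (_ : 1%N == _ = false) ?andbF ?oppr0 //; lia.
rewrite [LHS]hform_mon //=.
set B := `[< _ >]; have -> : B = ((l == 0) && (k.+1 == p ^ s))%N.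
  apply/idP/andP => [/(congP 1 0 k l (p ^ s) 0)[t [h1 h2]]|[/eqP h1 /eqP h2]].
    have t0 : t <= 0 by nia.
    have [k0 t0'] : (l = 0)%N /\ t = 0 by nia.
    by rewrite t0' in h1; lia.
  by apply/(congP 1 0 k l (p ^ s) 0); exists 0; lia.
by case: ifP; rewrite // sqrrN expr1n.
Qed.

(** * Reduction of a cocycle modulo coboundaries and the given cocycles *)

Lemma cobound2 (f : form1 L) : exists beta : form2 L, forall a b, beta a b = f (br a b).
Proof.
have [Dl Dr _ _] := hbr_lie n1 n2 pF.
have lr a : linear (fun b => f (br a b)) by move=> t u v; rewrite Dr linearP.
pose R a : {linear L -> F^o} := HB.pack (fun b => f (br a b))
  (GRing.isLinear.Build F L F^o _ _ (lr a)).
have RE a b : linfun (fun b => f (br a b)) b = f (br a b) by exact: (lfunE (R a)).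
have ll : linear (fun a => linfun (fun b => f (br a b)) : form1 L).
  by move=> t u v; apply/lfunP => b; rewrite add_lfunE scale_lfunE !RE Dl linearP.
pose R1 : {linear L -> form1 L} := HB.pack (fun a => linfun (fun b => f (br a b)) : form1 L)
  (GRing.isLinear.Build F L (form1 L) _ _ ll).
by exists (linfun R1) => a b; rewrite (lfunE R1) RE.
Qed.

(** The powers [p^s] are distinct, so for [t != 0] exactly one term survives. This matches a value
    of a cocycle with the multiples of the [psi] or the [phi]. *)
Lemma sum_pow_eq n N (t : F) :
  (t != 0 -> exists2 s, (0 < s <= n)%N & N = (p ^ s)%N) ->
  \sum_(s <- iota 1 n) t * (N == p ^ s)%N%:R = t.
Proof.
have p1 : (1 < p)%N := prime_gt1 (pcharf_prime pF).
case: (eqVneq t 0) => [-> _|_ /(_ isT)[s hs ->]].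
  by rewrite big1 // => s _; rewrite mul0r.
rewrite (bigD1_seq s) ?iota_uniq ?mem_iota ?add1n ?ltnS //= eqxx mulr1 big1 ?addr0 //.
by move=> s' ne; rewrite eqn_exp2l // eq_sym (negbTE ne) mulr0.
Qed.

Lemma sum_form2E (I : eqType) (s : seq I) (c : I -> F) (f : I -> form2 L) a b :
  (\sum_(i <- s) c i *: f i) a b = \sum_(i <- s) c i * f i a b.
Proof. by rewrite !sum_lfunE; apply: eq_bigr => i _; rewrite !scale_lfunE. Qed.

Lemma Z2_decomposition theta : theta \in Z2 br -> exists c d : nat -> F,
  theta - (\sum_(s <- iota 1 n1) c s *: psi s + \sum_(r <- iota 1 n2) d r *: phi r)
    \in B2 br.
Proof.
move=> Zt.
(* The values are dictated by the normalisation: [[x, x^(k) y^(l+1)] = - x^(k) y^(l)] and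
   [[y, x^(k+1) y^(Q-1)] = x^(k) y^(Q-1)]. The corner is [e], fixed by [[x, y] = - e]. *)
pose g (k l : nat) : F := if l == Q.-1 then
    if k == P.-1 then - theta x y else theta y (hmon k.+1 Q.-1)
  else - theta x (hmon k l.+1).
(* A linear form with prescribed values on monomials, obtained from a bilinear one whose
   coefficients ignore the first argument. *)
pose f : form1 L := @hform F p n1 n2 (fun _ m => g m.1 m.2) x.
have fE k l : (k < P)%N -> (l < Q)%N -> (k, l) != (0, 0)%N -> f (hmon k l) = g k l.
  by move=> hk hl nkl; rewrite /f hform_mon.
have [beta betaE] := cobound2 f.
have Bb : beta \in B2 br by apply/mem_B2; exists f.
have Zb : theta - beta \in Z2 br.
  by rewrite memvB //; apply: (subvP (B2_sub_Z2 (hbr_lie n1 n2 pF))).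
set theta1 := theta - beta in Zb.
have t1E a b : theta1 a b = theta a b - f (br a b).
  by rewrite /theta1 !add_lfunE !opp_lfunE betaE.
(* The signs come from [psi_s(x, x^(p^s-1)) = 1] and [phi_r(y, y^(p^r-1)) = -1]. *)
pose c s := theta1 x (hmon (p ^ s).-1 0); pose d r := - theta1 y (hmon 0 (p ^ r).-1).
exists c, d; set sg := (X in theta - X).
suff /eqP : theta1 - sg = 0.
  by rewrite subr_eq0 => /eqP <-; rewrite /theta1 opprB addrC subrK.
have coc1 : is_cocycle2 br theta1 by apply/mem_Z2.
have sx a b : (theta1 - sg) a b = theta1 a b - \sum_(s <- iota 1 n1) c s * psi s a b
    - \sum_(r <- iota 1 n2) d r * phi r a b.
  by rewrite /sg !add_lfunE !opp_lfunE !add_lfunE !sum_form2E opprD addrA.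
have sum0 n (u h : nat -> F) : (forall r, (0 < r)%N -> h r = 0) ->
    \sum_(r <- iota 1 n) u r * h r = 0.
  move=> h0; rewrite big_seq big1 // => r; rewrite mem_iota => /andP[r0 _].
  by rewrite h0 ?mulr0.
apply: (cocycle_eq0 pF p_odd n1_gt0 n2_gt0) => [|b|l hl|k hk].
- apply/mem_Z2/memvB => //; apply: memvD; apply: memv_suml => i _; apply: memvZ;
    apply/mem_Z2.
    exact: psi_cocycle.
  exact: phi_cocycle.
- rewrite (@hmon_ext _ _ _ _ _ ((theta1 - sg) x) 0) ?zero_lfunE // => k l hk hl.
  rewrite zero_lfunE sx [X in _ - X]sum0 ?subr0 => [|r r0]; last exact: phi_x.
  case: l hl => [|l] hl.
    rewrite (eq_big_seq (fun s => theta1 x (hmon k 0) * (k.+1 == p ^ s)%N%:R)) => [|s].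
      rewrite sum_pow_eq ?subrr // => t0.
      apply: (cocycle_xx_pow pF p_odd n1_gt0 n2_gt0 coc1) => //.
      by rewrite hk andbT lt0n; apply: contraNneq t0 => ->;
        rewrite (hmon00 F p n1 n2) linear0.
    rewrite mem_iota => /andP[s0 _]; rewrite psi_x //=.
    by case: eqP => [ks|]; rewrite ?mulr0 // /c -ks.
  rewrite sum0 ?subr0 => [|s s0]; last by rewrite psi_x.
  rewrite t1E hbr_xS // linearN /= opprK /hmon_deg; case: eqP => [[-> ->]|/eqP nkl].
    by rewrite fE ?/g ?eqxx ?subrr // ?xpair_eqE; lia.
  rewrite fE // ?(ltnW hl) // /g (_ : l == Q.-1 = false) ?subrr //.
  by apply/eqP; lia.
- rewrite sx sum0 ?subr0 => [|s s0]; last exact: psi_y.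
  rewrite (eq_big_seq (fun r => theta1 y (hmon 0 l) * (l.+1 == p ^ r)%N%:R)) => [|r].
    rewrite sum_pow_eq ?subrr // => t0.
    apply: (cocycle_yy_pow pF p_odd n1_gt0 n2_gt0 coc1) => //.
    by rewrite hl andbT lt0n; apply: contraNneq t0 => ->;
        rewrite (hmon00 F p n1 n2) linear0.
  rewrite mem_iota => /andP[r0 _]; rewrite phi_y //=.
  by case: eqP => [lr|]; rewrite ?oppr0 ?mulr0 // /d -lr mulrNN.
- rewrite sx !sum0 ?subr0 => [|r r0|s s0]; last exact: psi_y.
    rewrite t1E hbr_yS // hmon_deg_neq0; last by rewrite xpair_eqE; lia.
    rewrite fE; try lia.
      by rewrite /g eqxx (_ : k == P.-1 = false) ?subrr //; apply/eqP; lia.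
    by rewrite xpair_eqE; lia.
  by rewrite phi_y //= ?oppr0 //; lia.
Qed.

(** * The basis of the second cohomology group *)

Definition class_eval (a b : L) : 'Hom(quotv (B2 br), F^o) :=
  linfun (fun q : quotv (B2 br) => (quot_repr q : form2 L) a b : F^o).

(** Two representatives differ by a coboundary, which vanishes on a commuting pair. *)
Lemma class_evalE a b theta : br a b = 0 ->
  class_eval a b (cohom_class br theta) = theta a b.
Proof.
move=> ab0; have lin : linear (fun q : quotv (B2 br) => (quot_repr q : form2 L) a b : F^o).
  by move=> t u v; rewrite quot_reprP form2P.
pose R : {linear quotv (B2 br) -> F^o} :=
  HB.pack (fun q : quotv (B2 br) => (quot_repr q : form2 L) a b : F^o)
  (GRing.isLinear.Build F (quotv (B2 br)) F^o _ _ lin).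
rewrite /class_eval (lfunE R) /=.
have /mem_B2[f fE] := quot_pi_repr (B2 br) theta.
have := fE a b; rewrite ab0 linear0 add_lfunE opp_lfunE add_lfunE opp_lfunE.
by move/eqP; rewrite subr_eq0 => /eqP.
Qed.

Definition basis_form (i : bool * nat) : form2 L :=
  if i.1 then phi i.2 else psi i.2.

Definition basis_index : seq (bool * nat) :=
  [seq (true, r) | r <- iota 1 n2] ++ [seq (false, s) | s <- iota 1 n1].

Lemma mem_basis_index i :
  (i \in basis_index) = (0 < i.2 <= if i.1 then n2 else n1)%N.
Proof.
case: i => b m; rewrite mem_cat.
have mE b' n : ((b, m) \in [seq (b', r) | r <- iota 1 n]) = (b == b') && (0 < m <= n)%N.
  apply/mapP/andP => [[r]|[/eqP -> hm]].
    by rewrite mem_iota add1n ltnS => hr [-> ->].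
  by exists m => //; rewrite mem_iota add1n ltnS.
by rewrite !mE; case: b {mE} => /=; rewrite ?orbF.
Qed.

Lemma basis_index_uniq : uniq basis_index.
Proof.
rewrite cat_uniq !map_inj_uniq ?iota_uniq //= ?andbT => [|? ? []|? ? []] //.
by apply/hasPn => _ /mapP[r _ ->]; apply/mapP => -[].
Qed.

Lemma basis_form_cocycle i : basis_form i \in Z2 br.
Proof.
by apply/mem_Z2; rewrite /basis_form; case: i.1; [apply: phi_cocycle|apply: psi_cocycle].
Qed.

Lemma cohom_basis_span :
  <<[seq cohom_class br (basis_form i) | i <- basis_index]>>%VS = H2 br.
Proof.
apply/eqP; rewrite eqEsubv; apply/andP; split.
  by apply/span_subvP => _ /mapP[i _ ->]; apply/memv_img/basis_form_cocycle.
apply/subvP => _ /memv_imgP[theta Zt ->].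
have [c [d /quot_piP ->]] := Z2_decomposition Zt.
rewrite linearD !linear_sum; apply: memvD; rewrite big_seq; apply: memv_suml => m.
  rewrite mem_iota add1n ltnS => hm; rewrite linearZ memvZ // memv_span //.
  by apply/mapP; exists (false, m) => //; rewrite mem_basis_index.
rewrite mem_iota add1n ltnS => hm; rewrite linearZ memvZ // memv_span //.
by apply/mapP; exists (true, m) => //; rewrite mem_basis_index.
Qed.

Lemma cohom_basis_free :
  free [seq cohom_class br (basis_form i) | i <- basis_index].
Proof.
pose pt (i : bool * nat) : L * L :=
  if i.1 then (y, hmon 0 (p ^ i.2).-1) else (x, hmon (p ^ i.2).-1 0).
have p1 : (1 < p)%N := prime_gt1 (pcharf_prime pF).
have q0 r : (0 < p ^ r)%N := expn_pchar_gt0 pF r.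
have ptE i theta : class_eval (pt i).1 (pt i).2 (cohom_class br theta)
    = theta (pt i).1 (pt i).2.
  by rewrite class_evalE // /pt; case: i.1; rewrite ?hbr_y0 ?hbr_x0.
have ltp m n : (m <= n)%N -> ((p ^ m).-1 < p ^ n)%N.
  by move=> mn; rewrite prednK ?leq_exp2l.
apply: (free_dual (E := fun i => class_eval (pt i).1 (pt i).2)) basis_index_uniq _ _.
- case=> b m; rewrite mem_basis_index ptE /pt /basis_form /= => /andP[m0 hm].
  case: b hm => hm /=.
    by rewrite phi_y ?ltp // prednK // !eqxx oppr_eq0 oner_eq0.
  by rewrite psi_x ?ltp // prednK // !eqxx oner_eq0.
- move=> [b m] [b' m']; rewrite !mem_basis_index ptE /pt /basis_form xpair_eqE /=.
  move=> /andP[m0 hm] /andP[m'0 hm']; case: b hm; case: b' hm' => hm' hm ne /=.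
  + by rewrite phi_y ?ltp // prednK // eqn_exp2l // (negbTE ne) oppr0.
  + by rewrite psi_y.
  + by rewrite phi_x.
  + by rewrite psi_x ?ltp // prednK // eqn_exp2l // (negbTE ne).
Qed.

End Basis.

Theorem theorem4p2 (F : fieldType) (p n1 n2 : nat)
  (pF : p \in [pchar F]) (p_odd : odd p)
  (n1_gt0 : (0 < n1)%N) (n2_gt0 : (0 < n2)%N) :
  let br := @hbr F p n1 n2 in
  [/\ forall r : nat, (0 < r <= n2)%N -> phi F p n1 n2 r \in Z2 br,
      forall s : nat, (0 < s <= n1)%N -> psi F p n1 n2 s \in Z2 br
    & basis_of (H2 br)
        ([seq cohom_class br (phi F p n1 n2 r) | r <- iota 1 n2] ++
         [seq cohom_class br (psi F p n1 n2 s) | s <- iota 1 n1])].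
Proof.
split=> [r _|s _|]; [apply/mem_Z2/phi_cocycle|apply/mem_Z2/psi_cocycle|] => //.
have := cohom_basis_free pF p_odd n1_gt0 n2_gt0.
have := cohom_basis_span pF p_odd n1_gt0 n2_gt0.
rewrite /basis_index map_cat -!map_comp => spanE freeE.
by rewrite /basis_of spanE eqxx.
Qed.
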